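(* Let $i\in\mathbb{N}_0$ and let $\alpha,\beta\in\mathbb{C}$. Then $$F^{1:1;3}_{1:0;2}\left[\begin{matrix}\alpha: & \tfrac32\beta-\tfrac12\alpha-1-i\,; & \tfrac{\alpha-\beta}{2}+1+i,\ 1+\tfrac12\alpha,\ \tfrac{\alpha-\beta}{2}\,;\\ \beta: & -\,; & \tfrac12\alpha,\ 1+\tfrac{\alpha+\beta}{2}\,;\end{matrix}\ \tfrac12,\ \tfrac12\right] =\frac{2^{\alpha-1}\,\Gamma\!\left(\frac12\beta-\frac12\alpha-i\right)\Gamma\!\left(1+\frac{\alpha+\beta}{2}\right)}{\Gamma\!\left(\frac12\beta-\frac12\alpha\right)\Gamma(1+\alpha)}\sum_{r=0}^{i}(-1)^r\binom{i}{r}\frac{\Gamma\!\left(\frac{\alpha+r+1}{2}\right)}{\Gamma\!\left(\frac{\beta+r+1}{2}-i\right)}$$ and $$F^{1:1;3}_{1:0;2}\left[\begin{matrix}\alpha: & \tfrac32\beta-\tfrac12\alpha-1+i\,; & \tfrac{\alpha-\beta}{2}+1-i,\ 1+\tfrac12\alpha,\ \tfrac{\alpha-\beta}{2}\,;\\ \beta: & -\,; & \tfrac12\alpha,\ 1+\tfrac{\alpha+\beta}{2}\,;\end{matrix}\ \tfrac12,\ \tfrac12\right] =\frac{2^{\alpha-1}\,\Gamma\!\left(1+\frac{\alpha+\beta}{2}\right)}{\Gamma(1+\alpha)}\sum_{r=0}^{i}\binom{i}{r}\frac{\Gamma\!\left(\frac{\alpha+r+1}{2}\right)}{\Gamma\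!\left(\frac{\beta+r+1}{2}\right)}.$$
   Context: For $\lambda\in\mathbb{C}$ and $n\in\mathbb{N}_0$, $(\lambda)_0=1$ and $(\lambda)_n=\lambda(\lambda+1)\cdots(\lambda+n-1)$; $\Gamma$ is Euler's Gamma function and $\binom{i}{r}$ the binomial coefficient. The (generalized) Kampé de Fériet function is defined by $$F^{H:A;B}_{G:C;D}\left[\begin{matrix}(h_H): & (a_A)\,; & (b_B)\,;\\ (g_G): & (c_C)\,; & (d_D)\,;\end{matrix}\ x,\ y\right]=\sum_{m=0}^\infty\sum_{n=0}^\infty\frac{\prod_{j=1}^H(h_j)_{m+n}\prod_{j=1}^A(a_j)_m\prod_{j=1}^B(b_j)_n}{\prod_{j=1}^G(g_j)_{m+n}\prod_{j=1}^C(c_j)_m\prod_{j=1}^D(d_j)_n}\frac{x^m}{m!}\frac{y^n}{n!},$$ where a dash ''$-$'' denotes an empty list of parameters (empty products equal $1$). Parameters are tacitly assumed to be such that the double series converges, no denominator parameter is a non-positive integer, and all Gamma values appearing are finite. *)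

(* Defs.v *)
From Stdlib Require Import Reals List Arith Factorial.
From Coquelicot Require Import Coquelicot.
Open Scope C_scope.

Definition cexp (z : C) : C :=
  RtoC (exp (Re z)) * (cos (Im z), sin (Im z)).
Definition cpow (a : R) (z : C) : C := cexp (z * RtoC (ln a)).

Fixpoint poch (a : C) (n : nat) : C :=
  match n with
  | O => 1
  | S k => poch a k * (a + RtoC (INR k))
  end.

(** Euler's Gamma function on C via Gauss' product formula
    Gamma z = lim_{n->oo} n^z n! / (z (z+1) ... (z+n)),
    valid for every z not a non-positive integer. *)
Definition gauss_seq (z : C) (n : nat) : C :=
  cpow (INR n) z * RtoC (INR (fact n)) / poch z (S n).
Definition Gamma (z : C) : C :=
  (real (Lim_seq (fun n => Re (gauss_seq z n))),
   real (Lim_seq (fun n => Im (gauss_seq z n)))).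

Definition nonpos_int (z : C) : Prop := exists k : nat, z = RtoC (- INR k).

Definition pochs (l : list C) (n : nat) : C :=
  fold_right (fun a acc => poch a n * acc) 1 l.

Definition kdf_term (hs gs as_ bs cs ds : list C) (x y : C) (m n : nat) : C :=
  (pochs hs (m + n) * pochs as_ m * pochs bs n)
  / (pochs gs (m + n) * pochs cs m * pochs ds n)
  * (pow_n x m / RtoC (INR (fact m))) * (pow_n y n / RtoC (INR (fact n))).

Definition kdf_sum (hs gs as_ bs cs ds : list C) (x y : C) (v : C) : Prop :=
  exists g : nat -> C,
    (forall m, is_series (fun n => kdf_term hs gs as_ bs cs ds x y m n) (g m))
    /\ is_series g v.

(* Main.v *)
Require Import Defs.
From Stdlib Require Import Reals List Lra Lia Arith Factorial Classical_Prop.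
From Coquelicot Require Import Coquelicot.
Import ListNotations.
Open Scope C_scope.

(* Fix [d = 1 + (alpha + beta) / 2] and let [c] be the first parameter of the
   second group, so that the parameter of the first group is [beta - c].
   Comparing the coefficients of [x^N] (three terminating Chu-Vandermonde
   summations) gives
     F(x, x) = (1 - x) 2F1(1 + alpha, d - c; d; x),   d - c = beta -/+ i,
   and the double series converges absolutely at x = 1/2.  What remains is the
   value of 2F1(a, b -/+ i; (a + b + 1) / 2; 1/2).  With 2F1 divided by
   Gamma(d), two contiguous relations that hold coefficientwise reproduce
   Pascal's rule for the sums over [r], and reduce the claim to [i = 0], Gauss's
   second summation theorem.  There the hypergeometric equation at x = 1/2 has no
   first-order term and links (a, b) to (a + 2, b + 2); iterating this, Euler's
   transformation and the asymptotics of Gamma determine the value. *)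

(** Why the division by [Gamma d]: the contiguous relations move the lower parameter by 1, and
    lowering it may reach a non-positive integer. Since [/ 0 = 0] and the Gauss limit is 0 at the
    poles, [/ Gamma z] is the entire function 1/Gamma with its functional equation valid everywhere,
    and the relations hold for every lower parameter.

    Why Euler's transformation: the step to (a + 2, b + 2) raises all three parameters a, b, c of
    the series by 2, so its limit is not visible. But c - a and c - b stay fixed; once they are the
    upper parameters, only the lower one grows, the series tends to 1, and the powers and Gamma
    values compensate. A quantity constant along the steps then equals its limit 1, and sqrt(pi)
    never appears.

    Why the coefficients of the double series collapse: d = 1 + alpha - b with b = (alpha - beta) /
    2, exactly the case in which the inner 3F2 with the pair 1 + alpha / 2 over alpha / 2 is a
    product, and this product contains the Pochhammer symbol of beta = alpha - 2 b that cancels the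
    denominator. *)

Local Notation good z := (~ nonpos_int z).
Local Notation "# n" := (RtoC (INR n)) (at level 1, format "# n").

(* [sum_n] types its result as a carrier that [ring] and [field] do not
   recognize as [C]. *)
Ltac to_C := match goal with |- @eq _ ?x ?y => change (@eq C x y) end.
Ltac cring := to_C; ring.
Ltac cfield := to_C; field.

(** * Casts to the complex numbers, poles of Gamma, Pochhammer symbols *)

Lemma RtoC_INR_S (n : nat) : #(S n) = #n + 1.
Proof. rewrite S_INR, RtoC_plus; reflexivity. Qed.

Lemma RtoC_INR_plus (m n : nat) : #(m + n) = #m + #n.
Proof. rewrite plus_INR, RtoC_plus; reflexivity. Qed.

Lemma RtoC_INR_minus (m n : nat) : (n <= m)%nat -> #(m - n) = #m - #n.
Proof. intros H; rewrite minus_INR by exact H; apply RtoC_minus. Qed.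

Lemma RtoC_neq_0 (x : R) : x <> 0%R -> RtoC x <> 0.
Proof. intros Hx H; apply Hx; exact (f_equal fst H). Qed.

Lemma RtoC_INR_S_neq_0 (n : nat) : #n + 1 <> 0.
Proof. rewrite <- RtoC_INR_S; apply RtoC_neq_0, not_0_INR; lia. Qed.

Lemma C2_neq_0 : RtoC 2 <> 0.
Proof. apply RtoC_neq_0; lra. Qed.

Lemma fact_C_neq_0 (n : nat) : #(fact n) <> 0.
Proof. apply RtoC_neq_0, INR_fact_neq_0. Qed.

Lemma fact_C_S (n : nat) : #(fact (S n)) = (#n + 1) * #(fact n).
Proof. rewrite fact_simpl, mult_INR, RtoC_mult, RtoC_INR_S; reflexivity. Qed.

Lemma Cinv_0 : / RtoC 0 = 0.
Proof.
  unfold Cinv, RtoC; simpl.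
  f_equal; unfold Rdiv; rewrite ?Ropp_0; apply Rmult_0_l.
Qed.

Lemma Cinv_neq_0 (x : C) : x <> 0 -> / x <> 0.
Proof.
  intros Hx H; apply C1_nz.
  rewrite <- (Cinv_r x Hx), H; apply Cmult_0_r.
Qed.

Lemma good_add_neq_0 (z : C) (n : nat) : good z -> z + #n <> 0.
Proof.
  intros Hz H; apply Hz; exists n.
  rewrite RtoC_opp.
  replace z with (z + #n - #n) by ring.
  rewrite H; ring.
Qed.

Lemma good_neq_0 (z : C) : good z -> z <> 0.
Proof.
  intros Hz; replace z with (z + #0) by (simpl; ring).
  now apply good_add_neq_0.
Qed.

Lemma good_add (z : C) (n : nat) : good z -> good (z + #n).
Proof.
  intros Hz [k Hk]; apply Hz; exists (k + n)%nat.
  rewrite plus_INR, Ropp_plus_distr, RtoC_plus, <- Hk, RtoC_opp; ring.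
Qed.

Lemma good_S (z : C) : good z -> good (z + 1).
Proof. exact (good_add z 1). Qed.

Lemma good_Re_pos (z : C) : (0 < Re z)%R -> good z.
Proof.
  intros Hz [k ->]; rewrite re_RtoC in Hz.
  pose proof (pos_INR k); lra.
Qed.

Lemma good_half (z : C) : good z -> good (z / 2).
Proof.
  intros Hz [k Hk]; apply Hz; exists (k + k)%nat.
  replace z with (z / 2 + z / 2) by field.
  rewrite Hk, <- RtoC_plus, plus_INR; f_equal; ring.
Qed.

Lemma poch_S (z : C) (n : nat) : poch z (S n) = poch z n * (z + #n).
Proof. reflexivity. Qed.

Lemma poch_add (z : C) (m n : nat) : poch z (m + n) = poch z m * poch (z + #m) n.
Proof.
  induction n as [| n IH].
  - rewrite Nat.add_0_r; simpl; ring.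
  - rewrite Nat.add_succ_r, !poch_S, IH, RtoC_INR_plus; ring.
Qed.

Lemma poch_S_l (z : C) (n : nat) : poch z (S n) = z * poch (z + 1) n.
Proof.
  change (S n) with (1 + n)%nat; rewrite poch_add; simpl.
  replace (z + 0) with z by ring; ring.
Qed.

Lemma poch_neq_0 (z : C) (n : nat) : good z -> poch z n <> 0.
Proof.
  intros Hz; induction n as [| n IH].
  - exact C1_nz.
  - rewrite poch_S; apply Cmult_neq_0; [exact IH | now apply good_add_neq_0].
Qed.

(** * Finite complex sums and binomial coefficients *)

Lemma csum_0 (f : nat -> C) : sum_n f 0 = f 0%nat.
Proof. apply sum_O. Qed.

Lemma csum_S (f : nat -> C) (n : nat) : sum_n f (S n) = sum_n f n + f (S n).
Proof. exact (sum_Sn (G := C_AbelianMonoid) f n). Qed.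

Lemma csum_ext (f g : nat -> C) (n : nat) :
  (forall k, (k <= n)%nat -> f k = g k) -> sum_n f n = sum_n g n.
Proof. apply sum_n_ext_loc. Qed.

Lemma csum_mult_l (c : C) (f : nat -> C) (n : nat) :
  sum_n (fun k => c * f k) n = c * sum_n f n.
Proof. exact (sum_n_mult_l (K := C_Ring) c f n). Qed.

Lemma csum_plus (f g : nat -> C) (n : nat) :
  sum_n (fun k => f k + g k) n = sum_n f n + sum_n g n.
Proof. exact (sum_n_plus (G := C_AbelianMonoid) f g n). Qed.

Lemma csum_minus (f g : nat -> C) (n : nat) :
  sum_n (fun k => f k - g k) n = sum_n f n - sum_n g n.
Proof.
  induction n as [| n IH]; [now rewrite !csum_0 | rewrite !csum_S, IH; cring].
Qed.

Lemma csum_S_l (f : nat -> C) (n : nat) :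
  sum_n f (S n) = f 0%nat + sum_n (fun k => f (S k)) n.
Proof.
  induction n as [| n IH].
  - now rewrite csum_S, !csum_0.
  - rewrite csum_S, IH, csum_S; cring.
Qed.

(** Both sides run over the pairs n + k <= N, grouped on the right by M = n + k; this is the
    interchange behind the double sums below. *)
Lemma csum_triangle (f : nat -> nat -> C) (N : nat) :
  sum_n (fun n => sum_n (f n) (N - n)) N
  = sum_n (fun M => sum_n (fun n => f n (M - n)%nat) M) N.
Proof.
  induction N as [| N IH].
  - rewrite !csum_0; reflexivity.
  - rewrite csum_S, Nat.sub_diag, csum_0.
    rewrite (csum_ext _ (fun n => sum_n (f n) (N - n) + f n (S N - n)%nat)).
    + rewrite csum_plus, IH, csum_S.
      rewrite (csum_S (fun n => f n (S N - n)%nat)), Nat.sub_diag; cring.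
    + intros k Hk; rewrite Nat.sub_succ_l by exact Hk; apply csum_S.
Qed.

Definition bin (n k : nat) : C := RtoC (Binomial.C n k).

Lemma bin_0_r (n : nat) : bin n 0 = 1.
Proof. unfold bin; now rewrite C_n_0. Qed.

Lemma bin_diag (n : nat) : bin n n = 1.
Proof. unfold bin; now rewrite C_n_n. Qed.

Lemma bin_fact (n k : nat) :
  bin n k = #(fact n) / (#(fact k) * #(fact (n - k))).
Proof.
  unfold bin, Binomial.C.
  rewrite RtoC_div, RtoC_mult; [reflexivity |].
  apply Rmult_integral_contrapositive; split; apply INR_fact_neq_0.
Qed.

(** Pascal's rule as an induction step on the order of a binomial sum: in the applications, shifting
    the sequence amounts to shifting parameters, so both halves are instances of the induction
    hypothesis. *)
Lemma csum_pascal (u : nat -> C) (n : nat) :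
  sum_n (fun k => bin (S n) k * u k) (S n)
  = sum_n (fun k => bin n k * u k) n + sum_n (fun k => bin n k * u (S k)) n.
Proof.
  destruct n as [| n].
  { rewrite csum_S, !csum_0, !bin_0_r, bin_diag; cring. }
  rewrite csum_S, csum_S_l, !bin_0_r, bin_diag.
  rewrite (csum_ext _ (fun k => bin (S n) (S k) * u (S k) + bin (S n) k * u (S k))).
  - rewrite csum_plus.
    rewrite (csum_S_l (fun k => bin (S n) k * u k)), bin_0_r.
    rewrite (csum_S (fun k => bin (S n) k * u (S k))), bin_diag; cring.
  - intros k Hk; unfold bin.
    rewrite <- pascal by lia; rewrite RtoC_plus; cring.
Qed.

(** * Finite summations *)

(** Shifting k to k + 1 turns (b, c) into (b + 1, c + 1), up to the factor -b / c, and leaves c - b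
    alone. *)
Lemma chu_vandermonde (m : nat) : forall b c : C, good c ->
  sum_n (fun k => bin m k * ((-1) ^ k * (poch b k / poch c k))) m
  = poch (c - b) m / poch c m.
Proof.
  induction m as [| m IH]; intros b c Hc.
  - rewrite csum_0, bin_0_r; simpl; cring.
  - rewrite csum_pascal, IH by exact Hc.
    rewrite (csum_ext _ (fun k => (- b / c) *
      (bin m k * ((-1) ^ k * (poch (b + 1) k / poch (c + 1) k))))).
    + rewrite csum_mult_l, IH by now apply good_S.
      replace (c + 1 - (b + 1)) with (c - b) by cring.
      assert (H : poch c m * (c + #m) = c * poch (c + 1) m)
        by (rewrite <- poch_S; apply poch_S_l).
      pose proof (poch_neq_0 c m Hc) as H1.
      pose proof (poch_neq_0 (c + 1) m (good_S c Hc)) as H2.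
      pose proof (good_neq_0 c Hc) as H3.
      pose proof (good_add_neq_0 c m Hc) as H4.
      rewrite !poch_S.
      transitivity (poch (c - b) m / poch c m
                    - b * poch (c - b) m / (poch c m * (c + #m))).
      * rewrite H; cfield; auto.
      * cfield; auto.
    + intros k _; rewrite !poch_S_l, Cpow_S.
      pose proof (poch_neq_0 (c + 1) k (good_S c Hc)).
      pose proof (good_neq_0 c Hc).
      cfield; auto.
Qed.

(** A linear weight h + k is a parameter pair h + 1 over h. The induction is the previous one, with
    h + 1 in the shifted half. For [m = 0] the [pred] is harmless because of its factor [#m]. *)
Lemma chu_vandermonde_shifted (m : nat) : forall h b c : C, good c ->
  sum_n (fun k => bin m k * ((-1) ^ k * ((h + #k) * (poch b k / poch c k)))) m
  = (poch (c - b) m * h - #m * b * poch (c - b) (pred m)) / poch c m.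
Proof.
  induction m as [| m IH]; intros h b c Hc.
  - rewrite csum_0, bin_0_r; simpl; cfield; exact C1_nz.
  - rewrite csum_pascal, IH by exact Hc.
    rewrite (csum_ext _ (fun k => (- b / c) *
      (bin m k * ((-1) ^ k * ((h + 1 + #k) * (poch (b + 1) k / poch (c + 1) k)))))).
    + rewrite csum_mult_l, IH by now apply good_S.
      replace (c + 1 - (b + 1)) with (c - b) by cring.
      assert (H : poch c m * (c + #m) = c * poch (c + 1) m)
        by (rewrite <- poch_S; apply poch_S_l).
      pose proof (poch_neq_0 c m Hc) as H1.
      pose proof (poch_neq_0 (c + 1) m (good_S c Hc)) as H2.
      pose proof (good_neq_0 c Hc) as H3.
      pose proof (good_add_neq_0 c m Hc) as H4.
      transitivity ((poch (c - b) m * h - #m * b * poch (c - b) (pred m)) / poch c m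
        - b * (poch (c - b) m * (h + 1) - #m * (b + 1) * poch (c - b) (pred m))
          / (poch c m * (c + #m))).
      * rewrite H; cfield; auto.
      * rewrite (poch_S c m), RtoC_INR_S.
        destruct m as [| m]; simpl pred.
        { simpl; cfield; auto. }
        rewrite !(poch_S (c - b)), RtoC_INR_S in *.
        cfield; split; [exact H4 | exact H1].
    + intros k _; rewrite !poch_S_l, Cpow_S, RtoC_INR_S.
      pose proof (poch_neq_0 (c + 1) k (good_S c Hc)).
      pose proof (good_neq_0 c Hc).
      cfield; auto.
Qed.

Lemma vandermonde (s t : C) (n : nat) :
  sum_n (fun k => bin n k * (poch s (n - k) * poch t k)) n = poch (s + t) n.
Proof.
  induction n as [| n IH].
  - rewrite csum_0, bin_0_r; simpl; cring.
  - rewrite csum_pascal, <- csum_plus.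
    rewrite (csum_ext _ (fun k => (s + t + #n) *
      (bin n k * (poch s (n - k) * poch t k)))).
    + rewrite csum_mult_l, IH, poch_S; cring.
    + intros k Hk.
      rewrite Nat.sub_succ_l by exact Hk.
      rewrite !poch_S, Nat.sub_succ, RtoC_INR_minus by exact Hk; cring.
Qed.

Lemma poch_succ_mult (h : C) (n : nat) : h * poch (1 + h) n = poch h n * (h + #n).
Proof. rewrite <- poch_S, poch_S_l, (Cplus_comm 1); reflexivity. Qed.

Lemma Cpow_m1_sub (m n : nat) : (n <= m)%nat ->
  (-1) ^ (m - n) = (-1) ^ m * (-1) ^ n.
Proof.
  intros H; replace m with (n + (m - n))%nat at 2 by lia.
  rewrite Cpow_add_r.
  assert (E : (-1) ^ n * (-1) ^ n = 1).
  { rewrite <- Cpow_mult_l; replace (-1 * -1) with (RtoC 1) by ring.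
    apply Cpow_1_l. }
  transitivity ((-1) ^ n * (-1) ^ n * (-1) ^ (m - n)); [| ring].
  rewrite E; ring.
Qed.

(** The quotient of (1 + alpha / 2)_n by (alpha / 2)_n is the linear weight 1 + 2 n / alpha, so the
    weighted Chu-Vandermonde sum applies. The lower parameter 1 + alpha - b is what makes its two
    terms combine into the product (alpha - 2 b)(alpha + m) / 2. *)
Lemma well_poised_3F2 (alpha b : C) (m : nat) :
  good alpha -> good (1 + alpha - b) ->
  sum_n (fun n => bin m n * ((-1) ^ n *
    (poch (1 + alpha / 2) n * poch b n
     / (poch (alpha / 2) n * poch (1 + alpha - b) n)))) m
  = poch (alpha - 2 * b) m * (alpha + #m) / (alpha * poch (1 + alpha - b) m).
Proof.
  intros Ha Hd.
  pose proof (good_neq_0 _ Ha) as Ha0.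
  pose proof (poch_neq_0 _ m Hd) as Hdm.
  rewrite (csum_ext _ (fun n => (2 / alpha) * (bin m n * ((-1) ^ n *
    ((alpha / 2 + #n) * (poch b n / poch (1 + alpha - b) n)))))).
  - rewrite csum_mult_l, chu_vandermonde_shifted by exact Hd.
    destruct m as [| m]; simpl pred.
    + simpl; cfield; auto using C1_nz.
    + rewrite (poch_S_l (alpha - 2 * b)), (poch_S (1 + alpha - b - b)), RtoC_INR_S.
      replace (alpha - 2 * b + 1) with (1 + alpha - b - b) by ring.
      cfield; auto.
  - intros n _.
    pose proof (poch_neq_0 _ n (good_half _ Ha)) as H1.
    pose proof (poch_neq_0 _ n Hd) as H2.
    assert (E : poch (1 + alpha / 2) n
                = (2 / alpha) * (poch (alpha / 2) n * (alpha / 2 + #n))).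
    { rewrite <- poch_succ_mult; field; exact Ha0. }
    rewrite E; cfield; auto.
Qed.

(** With beta = alpha - 2 b, Chu-Vandermonde read backwards expands (beta - c)_{N-n} / (beta +
    n)_{N-n} as an alternating sum over k. Grouped by M = n + k, the inner sum is the 3F2 above,
    whose (beta)_M cancels the one in the denominator; a sum with weight alpha + M remains. *)
Lemma kdf_antidiagonal (alpha b c : C) (N : nat) :
  good alpha -> good (alpha - 2 * b) -> good (1 + alpha - b) ->
  sum_n (fun n =>
    poch alpha N * poch (alpha - 2 * b - c) (N - n)
    * (poch c n * poch (1 + alpha / 2) n * poch b n)
    / (poch (alpha - 2 * b) N * (poch (alpha / 2) n * poch (1 + alpha - b) n)
       * #(fact (N - n)) * #(fact n))) N
  = poch alpha N / #(fact N)
    * ((poch (1 + alpha - b - c) N * alpha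
        - #N * c * poch (1 + alpha - b - c) (pred N))
       / (alpha * poch (1 + alpha - b) N)).
Proof.
  intros Ha Hb Hd.
  set (be := alpha - 2 * b) in *; set (d := 1 + alpha - b) in *.
  pose proof (good_neq_0 _ Ha) as Ha0.
  pose (x := fun n => poch (1 + alpha / 2) n * poch b n / (poch (alpha / 2) n * poch d n)).
  pose (f := fun n k => (x n / #(fact n)) *
    ((-1) ^ k * (poch c (n + k) / poch be (n + k))
     / (#(fact k) * #(fact (N - (n + k)))))).
  rewrite (csum_ext _ (fun n => poch alpha N * sum_n (f n) (N - n))).
  - rewrite csum_mult_l, csum_triangle.
    rewrite (csum_ext _ (fun M => / (alpha * #(fact N)) * (bin N M * ((-1) ^ M *
      ((alpha + #M) * (poch c M / poch d M)))))).
    + rewrite csum_mult_l, chu_vandermonde_shifted by exact Hd.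
      cfield; repeat split; auto using fact_C_neq_0, poch_neq_0.
    + intros M HM.
      rewrite (csum_ext _ (fun n =>
        ((-1) ^ M * poch c M / (poch be M * #(fact M) * #(fact (N - M))))
        * (bin M n * ((-1) ^ n * x n)))).
      * rewrite csum_mult_l; unfold x.
        unfold d in *; rewrite well_poised_3F2 by assumption; fold d; fold be.
        rewrite bin_fact.
        cfield; repeat split; auto using fact_C_neq_0, poch_neq_0.
      * intros n Hn; unfold f.
        replace (n + (M - n))%nat with M by lia.
        rewrite Cpow_m1_sub by exact Hn; rewrite bin_fact.
        cfield; repeat split; auto using fact_C_neq_0, poch_neq_0.
  - intros n Hn; unfold f; rewrite csum_mult_l.
    rewrite (csum_ext _ (fun k => (poch c n / (poch be n * #(fact (N - n)))) *
      (bin (N - n) k * ((-1) ^ k * (poch (c + #n) k / poch (be + #n) k))))).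
    + rewrite csum_mult_l, chu_vandermonde by now apply good_add.
      replace (be + #n - (c + #n)) with (be - c) by ring.
      assert (E : poch be N = poch be n * poch (be + #n) (N - n)).
      { rewrite <- poch_add; f_equal; lia. }
      rewrite E; unfold x.
      cfield; repeat split;
        auto using fact_C_neq_0, poch_neq_0, good_add, good_half.
    + intros k Hk; rewrite !poch_add, bin_fact.
      replace (N - n - k)%nat with (N - (n + k))%nat by lia.
      cfield; repeat split;
        auto using fact_C_neq_0, poch_neq_0, good_add, good_half.
Qed.

(** The Pfaff-Saalschuetz sum, as the coefficient of x^N in Euler's transformation. Once (c - a)_n /
    (c)_n is expanded in the (a)_j / (c)_j, the inner sum is a Vandermonde convolution equal to (a +
    j)_{N-j}; together with (a)_j this gives (a)_N, free of j. *)
Lemma saalschutz (a b c : C) (N : nat) : good c ->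
  sum_n (fun n => poch (a + b - c) (N - n) / #(fact (N - n))
    * (poch (c - a) n * poch (c - b) n / (poch c n * #(fact n)))) N
  = poch a N * poch b N / (poch c N * #(fact N)).
Proof.
  intros Hc.
  pose (f := fun j l => poch (a + b - c) (N - (j + l)) / #(fact (N - (j + l)))
    * ((-1) ^ j * (poch a j / poch c j) * poch (c - b) (j + l)
       / (#(fact j) * #(fact l)))).
  rewrite (csum_ext _ (fun n => sum_n (fun j => f j (n - j)%nat) n)).
  - rewrite <- csum_triangle.
    rewrite (csum_ext _ (fun j => (poch a N / #(fact N)) *
      (bin N j * ((-1) ^ j * (poch (c - b) j / poch c j))))).
    + rewrite csum_mult_l, chu_vandermonde by exact Hc.
      replace (c - (c - b)) with b by ring.
      cfield; repeat split; auto using fact_C_neq_0, poch_neq_0.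
    + intros j Hj.
      rewrite (csum_ext _ (fun l =>
        ((-1) ^ j * (poch a j / poch c j) * poch (c - b) j
          / (#(fact j) * #(fact (N - j))))
        * (bin (N - j) l * (poch (a + b - c) (N - j - l) * poch (c - b + #j) l)))).
      * rewrite csum_mult_l, vandermonde.
        replace (a + b - c + (c - b + #j)) with (a + #j) by ring.
        assert (E : poch a N = poch a j * poch (a + #j) (N - j)).
        { rewrite <- poch_add; f_equal; lia. }
        rewrite E, bin_fact.
        cfield; repeat split; auto using fact_C_neq_0, poch_neq_0.
      * intros l Hl; unfold f; rewrite bin_fact, poch_add.
        replace (N - j - l)%nat with (N - (j + l))%nat by lia.
        cfield; repeat split; auto using fact_C_neq_0, poch_neq_0.
  - intros n Hn; unfold f.
    rewrite (csum_ext _ (fun j =>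
      (poch (a + b - c) (N - n) / #(fact (N - n)) * (poch (c - b) n / #(fact n)))
      * (bin n j * ((-1) ^ j * (poch a j / poch c j))))).
    + rewrite csum_mult_l, chu_vandermonde by exact Hc.
      cfield; repeat split; auto using fact_C_neq_0, poch_neq_0.
    + intros j Hj; replace (j + (n - j))%nat with n by lia.
      rewrite bin_fact.
      cfield; repeat split; auto using fact_C_neq_0, poch_neq_0.
Qed.

(** * Limits and series of complex numbers *)

(** Componentwise, as [Gamma] is defined by two real limits. *)
Definition Clim (u : nat -> C) (l : C) : Prop :=
  is_lim_seq (fun n => Re (u n)) (Re l) /\ is_lim_seq (fun n => Im (u n)) (Im l).

Lemma Clim_const (c : C) : Clim (fun _ => c) c.
Proof. split; apply is_lim_seq_const. Qed.

Lemma Clim_ext_loc (u v : nat -> C) (l : C) (N : nat) :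
  (forall n, (N <= n)%nat -> u n = v n) -> Clim u l -> Clim v l.
Proof.
  intros E [H1 H2]; split.
  - apply is_lim_seq_ext_loc with (2 := H1).
    exists N; intros n Hn; now rewrite E.
  - apply is_lim_seq_ext_loc with (2 := H2).
    exists N; intros n Hn; now rewrite E.
Qed.

Lemma Clim_ext (u v : nat -> C) (l : C) :
  (forall n, u n = v n) -> Clim u l -> Clim v l.
Proof. intros E; apply (Clim_ext_loc u v l 0); auto. Qed.

Lemma Clim_plus (u v : nat -> C) (l m : C) :
  Clim u l -> Clim v m -> Clim (fun n => u n + v n) (l + m).
Proof. intros [H1 H2] [H3 H4]; split; apply is_lim_seq_plus'; assumption. Qed.

Lemma Clim_mult (u v : nat -> C) (l m : C) :
  Clim u l -> Clim v m -> Clim (fun n => u n * v n) (l * m).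
Proof.
  intros [H1 H2] [H3 H4]; split; simpl.
  - apply is_lim_seq_minus'; apply is_lim_seq_mult'; assumption.
  - apply is_lim_seq_plus'; apply is_lim_seq_mult'; assumption.
Qed.

Lemma Clim_inv (u : nat -> C) (l : C) :
  l <> 0 -> Clim u l -> Clim (fun n => / u n) (/ l).
Proof.
  intros Hl [H1 H2].
  assert (Hn : (Re l ^ 2 + Im l ^ 2)%R <> 0%R).
  { rewrite <- Cmod2_alt; apply pow_nonzero.
    apply Cmod_gt_0 in Hl; lra. }
  assert (Hd : is_lim_seq (fun n => Re (u n) ^ 2 + Im (u n) ^ 2)%R
                 (Re l ^ 2 + Im l ^ 2)%R).
  { apply is_lim_seq_ext with
      (fun n => Re (u n) * Re (u n) + Im (u n) * Im (u n))%R.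
    - intros n; simpl; ring.
    - replace (Re l ^ 2 + Im l ^ 2)%R
        with (Re l * Re l + Im l * Im l)%R by ring.
      apply is_lim_seq_plus'; apply is_lim_seq_mult'; assumption. }
  split; simpl.
  - apply is_lim_seq_div'; assumption.
  - apply is_lim_seq_div'; [| assumption | assumption].
    apply (is_lim_seq_opp (fun n => Im (u n)) (Im l)); assumption.
Qed.

Lemma Clim_unique (u : nat -> C) (l m : C) : Clim u l -> Clim u m -> l = m.
Proof.
  intros [H1 H2] [H3 H4].
  apply is_lim_seq_unique in H1, H2, H3, H4.
  assert (E1 : Re l = Re m) by congruence.
  assert (E2 : Im l = Im m) by congruence.
  now apply injective_projections.
Qed.

Lemma Clim_comp (u : nat -> C) (l : C) (phi : nat -> nat) :
  filterlim phi eventually eventually -> Clim u l -> Clim (fun n => u (phi n)) l.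
Proof.
  intros Hphi [H1 H2]; split.
  - exact (is_lim_seq_subseq (fun n => Re (u n)) _ phi Hphi H1).
  - exact (is_lim_seq_subseq (fun n => Im (u n)) _ phi Hphi H2).
Qed.

Lemma Clim_incr_1 (u : nat -> C) (l : C) : Clim (fun n => u (S n)) l -> Clim u l.
Proof.
  intros [H1 H2]; split.
  - exact (proj2 (is_lim_seq_incr_1 (fun n => Re (u n)) _) H1).
  - exact (proj2 (is_lim_seq_incr_1 (fun n => Im (u n)) _) H2).
Qed.

Lemma Im_le_Cmod (z : C) : (Rabs (Im z) <= Cmod z)%R.
Proof.
  apply Rle_trans with (2 := Rmax_Cmod z); apply Rmax_r.
Qed.

Lemma Clim_of_Cmod (u : nat -> C) (l : C) (e : nat -> R) :
  (forall n, Cmod (u n - l) <= e n)%R -> is_lim_seq e 0 -> Clim u l.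
Proof.
  intros H He.
  assert (K : forall f : nat -> R, (forall n, Rabs (f n) <= e n)%R -> is_lim_seq f 0).
  { intros f Hf; apply is_lim_seq_abs_0.
    apply is_lim_seq_le_le with (fun _ => 0%R) e;
      [| apply is_lim_seq_const | exact He].
    intros n; split; [apply Rabs_pos | apply Hf]. }
  split.
  - apply is_lim_seq_ext with (fun n => Re (u n - l) + Re l)%R.
    + intros n; simpl; unfold Re; ring.
    + replace (Finite (Re l)) with (Finite (0 + Re l)) by (f_equal; ring).
      apply is_lim_seq_plus'; [| apply is_lim_seq_const].
      apply K; intros n; apply Rle_trans with (2 := H n); apply re_le_Cmod.
  - apply is_lim_seq_ext with (fun n => Im (u n - l) + Im l)%R.
    + intros n; simpl; unfold Im; ring.
    + replace (Finite (Im l)) with (Finite (0 + Im l)) by (f_equal; ring).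
      apply is_lim_seq_plus'; [| apply is_lim_seq_const].
      apply K; intros n; apply Rle_trans with (2 := H n); apply Im_le_Cmod.
Qed.

Lemma is_lim_seq_Cmod (u : nat -> C) (l : C) :
  Clim u l -> is_lim_seq (fun n => Cmod (u n)) (Cmod l).
Proof.
  intros [H1 H2]; unfold Cmod.
  apply (is_lim_seq_continuous sqrt).
  - apply continuity_pt_sqrt.
    apply Rplus_le_le_0_compat; apply pow2_ge_0.
  - apply is_lim_seq_ext with
      (fun n => Re (u n) * Re (u n) + Im (u n) * Im (u n))%R.
    + intros n; unfold Re, Im; simpl; ring.
    + replace (fst l ^ 2 + snd l ^ 2)%R
        with (Re l * Re l + Im l * Im l)%R by (unfold Re, Im; ring).
      apply is_lim_seq_plus'; apply is_lim_seq_mult'; assumption.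
Qed.

Lemma is_series_Clim (a : nat -> C) (l : C) : is_series a l <-> Clim (sum_n a) l.
Proof.
  split.
  - intros H; split; apply filterlim_locally; intros eps.
    + apply (filter_imp (fun n => ball l eps (sum_n a n))); [now intros n [] |].
      now apply filterlim_locally.
    + apply (filter_imp (fun n => ball l eps (sum_n a n))); [now intros n [] |].
      now apply filterlim_locally.
  - intros [H1 H2]; apply filterlim_locally; intros eps.
    apply (proj1 (filterlim_locally _ _)) with (eps := eps) in H1.
    apply (proj1 (filterlim_locally _ _)) with (eps := eps) in H2.
    generalize (filter_and _ _ H1 H2); apply filter_imp.
    now intros n [].
Qed.

Lemma is_Cseries_unique (a : nat -> C) (l m : C) :
  is_series a l -> is_series a m -> l = m.
Proof. rewrite !is_series_Clim; apply Clim_unique. Qed.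

Lemma is_Cseries_ext (a b : nat -> C) (l : C) :
  (forall n, a n = b n) -> is_series a l -> is_series b l.
Proof. apply is_series_ext. Qed.

Lemma is_Cseries_mult_l (c : C) (a : nat -> C) (l : C) :
  is_series a l -> is_series (fun n => c * a n) (c * l).
Proof. exact (is_series_scal_l (V := C_NormedModule) c a l). Qed.

Lemma is_Cseries_plus (a b : nat -> C) (l m : C) :
  is_series a l -> is_series b m -> is_series (fun n => a n + b n) (l + m).
Proof. exact (is_series_plus (V := C_NormedModule) a b l m). Qed.

Lemma is_Cseries_minus (a b : nat -> C) (l m : C) :
  is_series a l -> is_series b m -> is_series (fun n => a n - b n) (l - m).
Proof. exact (is_series_minus (V := C_NormedModule) a b l m). Qed.

Lemma is_Cseries_shift (a b : nat -> C) (l : C) :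
  b 0%nat = 0 -> (forall n, b (S n) = a n) -> is_series a l -> is_series b l.
Proof.
  intros H0 HS Ha; apply is_series_decr_1; rewrite H0.
  apply (is_Cseries_ext a); [intros n; now rewrite HS |].
  change (is_series a (l + - RtoC 0)).
  replace (l + - RtoC 0) with l by ring; exact Ha.
Qed.

(** The factor 1 - rho^P makes the bound the exact geometric sum, so that the induction on [P]
    closes. *)
Lemma sum_n_Cmod_tail (a : nat -> C) (K rho : R) (L P : nat) :
  (0 <= rho < 1)%R -> (forall n, Cmod (a n) <= K * rho ^ n)%R ->
  (Cmod (sum_n a (L + P) - sum_n a L) <= K * rho ^ S L / (1 - rho) * (1 - rho ^ P))%R.
Proof.
  intros Hr Ha; induction P as [| P IH].
  - rewrite Nat.add_0_r.
    replace (sum_n a L - sum_n a L) with (RtoC 0) by cring.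
    rewrite Cmod_0; simpl; lra.
  - rewrite Nat.add_succ_r, csum_S.
    replace (sum_n a (L + P) + a (S (L + P)) - sum_n a L)
      with ((sum_n a (L + P) - sum_n a L) + a (S (L + P))) by cring.
    apply Rle_trans with (1 := Cmod_triangle _ _).
    apply Rle_trans with (1 := Rplus_le_compat _ _ _ _ IH (Ha _)).
    apply Req_le.
    replace (S (L + P)) with (S L + P)%nat by lia.
    rewrite pow_add; simpl; field; lra.
Qed.

Lemma is_series_Cmod_tail (a : nat -> C) (l : C) (K rho : R) (L : nat) :
  (0 <= rho < 1)%R -> (forall n, Cmod (a n) <= K * rho ^ n)%R -> is_series a l ->
  (Cmod (l - sum_n a L) <= K * rho ^ S L / (1 - rho))%R.
Proof.
  intros Hr Ha Hs; apply is_series_Clim in Hs.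
  assert (HK : (0 <= K)%R).
  { generalize (Ha 0%nat) (Cmod_ge_0 (a 0%nat)); simpl; lra. }
  assert (HB : (0 <= K * rho ^ S L / (1 - rho))%R).
  { apply Rmult_le_pos; [apply Rmult_le_pos; [exact HK | apply pow_le; lra] |].
    left; apply Rinv_0_lt_compat; lra. }
  assert (H : is_lim_seq (fun P => Cmod (sum_n a (P + L) + - sum_n a L))
                (Cmod (l + - sum_n a L))).
  { apply (is_lim_seq_Cmod (fun P => sum_n a (P + L) + - sum_n a L)).
    apply (Clim_plus (fun P => sum_n a (P + L)) (fun _ => - sum_n a L));
      [| apply Clim_const].
    apply (Clim_comp (sum_n a) l (fun P => (P + L)%nat)); [| exact Hs].
    intros Q [N HN]; exists N; intros n Hn; apply HN; lia. }
  refine (is_lim_seq_le _ (fun _ => K * rho ^ S L / (1 - rho))%R _ _ _ H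
            (is_lim_seq_const _)).
  intros P; rewrite Nat.add_comm.
  apply Rle_trans with (1 := sum_n_Cmod_tail a K rho L P Hr Ha).
  rewrite <- (Rmult_1_r (_ / _)) at 2.
  apply Rmult_le_compat_l; [exact HB |].
  assert (0 <= rho ^ P)%R by (apply pow_le; lra); lra.
Qed.

Definition CSeries (a : nat -> C) : C :=
  (Series (fun n => Re (a n)), Series (fun n => Im (a n))).

Lemma sum_n_Re (a : nat -> C) (n : nat) : Re (sum_n a n) = sum_n (fun k => Re (a k)) n.
Proof.
  induction n as [| n IH]; [now rewrite !sum_O |].
  rewrite csum_S, sum_Sn, <- IH; reflexivity.
Qed.

Lemma sum_n_Im (a : nat -> C) (n : nat) : Im (sum_n a n) = sum_n (fun k => Im (a k)) n.
Proof.
  induction n as [| n IH]; [now rewrite !sum_O |].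
  rewrite csum_S, sum_Sn, <- IH; reflexivity.
Qed.

Lemma is_series_CSeries (a : nat -> C) (K rho : R) :
  (0 <= rho < 1)%R -> (forall n, Cmod (a n) <= K * rho ^ n)%R ->
  is_series a (CSeries a).
Proof.
  intros Hr Ha.
  assert (HG : ex_series (fun n => K * rho ^ n)%R).
  { exists (K * / (1 - rho))%R.
    apply (is_series_scal_l (V := R_NormedModule)), is_series_geom.
    apply Rabs_def1; lra. }
  apply is_series_Clim; split.
  - apply is_lim_seq_ext with (sum_n (fun n => Re (a n))).
    + intros n; symmetry; apply sum_n_Re.
    + apply Series_correct.
      apply (ex_series_le (V := R_CompleteNormedModule)) with (2 := HG).
      intros n; apply Rle_trans with (2 := Ha n), re_le_Cmod.
  - apply is_lim_seq_ext with (sum_n (fun n => Im (a n))).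
    + intros n; symmetry; apply sum_n_Im.
    + apply Series_correct.
      apply (ex_series_le (V := R_CompleteNormedModule)) with (2 := HG).
      intros n; apply Rle_trans with (2 := Ha n), Im_le_Cmod.
Qed.

(** The sequence is the general term of the Cauchy square of the geometric series, which
    converges. *)
Lemma is_lim_seq_INR_geom (rho : R) :
  (0 <= rho < 1)%R -> is_lim_seq (fun n => rho ^ n * INR (S n))%R 0.
Proof.
  intros Hr.
  assert (Ha : Rabs rho < 1) by (apply Rabs_def1; lra).
  pose proof (is_series_geom rho Ha) as Hg.
  assert (He : ex_series (fun n => Rabs (rho ^ n))).
  { exists (/ (1 - rho))%R.
    apply is_series_ext with (2 := Hg).
    intros n; symmetry; apply Rabs_pos_eq, pow_le; lra. }
  apply ex_series_lim_0.
  exists (/ (1 - rho) * / (1 - rho))%R.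
  apply is_series_ext with (2 := is_series_mult _ _ _ _ Hg Hg He He).
  intros n; rewrite <- sum_cte; apply sum_eq; intros k Hk.
  rewrite <- pow_add; f_equal; lia.
Qed.

Lemma csum_Cmod_le (f : nat -> C) (B : R) (n : nat) :
  (forall k, (k <= n)%nat -> Cmod (f k) <= B)%R ->
  (Cmod (sum_n f n) <= B * INR (S n))%R.
Proof.
  induction n as [| n IH]; intros H.
  - rewrite csum_0; simpl; rewrite Rmult_1_r; auto.
  - rewrite csum_S, S_INR, Rmult_plus_distr_l, Rmult_1_r.
    apply Rle_trans with (1 := Cmod_triangle _ _).
    apply Rplus_le_compat; auto.
Qed.

(** The partial sums by rows and by antidiagonals differ by the tails of the rows m <= M beyond
    column M - m: there are M + 1 of them, each at most K rho^(M+1) / (1 - rho). *)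
Lemma double_series_antidiagonal (f : nat -> nat -> C) (g : nat -> C) (v : C) (K rho : R) :
  (0 <= rho < 1)%R -> (forall m n, Cmod (f m n) <= K * rho ^ (m + n))%R ->
  (forall m, is_series (f m) (g m)) ->
  is_series (fun N => sum_n (fun m => f m (N - m)%nat) N) v ->
  is_series g v.
Proof.
  intros Hr Hf Hg Hv; apply is_series_Clim in Hv; apply is_series_Clim.
  assert (HK : (0 <= K)%R).
  { generalize (Hf 0%nat 0%nat) (Cmod_ge_0 (f 0%nat 0%nat)); simpl; lra. }
  pose (D := sum_n (fun N => sum_n (fun m => f m (N - m)%nat) N)).
  apply Clim_ext with (fun M => D M + (sum_n g M - D M)).
  { intros M; unfold D; cring. }
  replace v with (v + 0) by ring.
  apply Clim_plus; [exact Hv |].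
  apply Clim_of_Cmod with (fun M => K * rho / (1 - rho) * (rho ^ M * INR (S M)))%R.
  - intros M; unfold D; rewrite <- csum_triangle.
    replace (sum_n g M - sum_n (fun m => sum_n (f m) (M - m)) M - 0)
      with (sum_n (fun m => g m - sum_n (f m) (M - m)) M)
      by (rewrite csum_minus; cring).
    rewrite <- Rmult_assoc; apply csum_Cmod_le.
    intros m Hm.
    assert (Hm' : forall n, (Cmod (f m n) <= K * rho ^ m * rho ^ n)%R).
    { intros n; rewrite Rmult_assoc, <- pow_add; apply Hf. }
    apply Rle_trans with (1 := is_series_Cmod_tail _ _ _ _ (M - m) Hr Hm' (Hg m)).
    apply Req_le.
    replace (rho ^ M)%R with (rho ^ m * rho ^ (M - m))%R
      by (rewrite <- pow_add; f_equal; lia).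
    simpl; field; lra.
  - replace (Finite 0) with (Finite (K * rho / (1 - rho) * 0)) by (f_equal; ring).
    apply is_lim_seq_mult'; [apply is_lim_seq_const |].
    now apply is_lim_seq_INR_geom.
Qed.

(** * Subexponential growth of coefficients *)

(** Pochhammer quotients grow polynomially, but this weaker property is stable under products,
    follows from a bound on successive ratios, and suffices for geometric decay at 1/2. *)
Definition subexp (w : nat -> C) : Prop :=
  forall q : R, (1 < q)%R -> exists K : R, forall n, (Cmod (w n) <= K * q ^ n)%R.

Lemma subexp_of_ratio (w : nat -> C) :
  (forall q : R, (1 < q)%R ->
     exists N : nat, forall n, (N <= n)%nat -> (Cmod (w (S n)) <= q * Cmod (w n))%R) ->
  subexp w.
Proof.
  intros H q Hq; destruct (H q Hq) as [N HN].
  assert (HB : exists B, forall n, (n <= N)%nat -> (Cmod (w n) <= B)%R).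
  { clear HN; induction N as [| N [B HB]].
    - exists (Cmod (w 0%nat)); intros n Hn; replace n with 0%nat by lia; lra.
    - exists (Rmax B (Cmod (w (S N)))); intros n Hn.
      destruct (Nat.eq_dec n (S N)) as [-> | Hne]; [apply Rmax_r |].
      apply Rle_trans with B; [apply HB; lia | apply Rmax_l]. }
  destruct HB as [B HB]; exists B.
  assert (HB0 : (0 <= B)%R).
  { apply Rle_trans with (2 := HB 0%nat (Nat.le_0_l N)), Cmod_ge_0. }
  assert (Hle : forall n, (n <= N)%nat -> (Cmod (w n) <= B * q ^ n)%R).
  { intros n Hn; apply Rle_trans with (1 := HB n Hn).
    rewrite <- (Rmult_1_r B) at 1.
    apply Rmult_le_compat_l; [exact HB0 | apply pow_R1_Rle; lra]. }
  induction n as [| n IH]; [apply Hle; lia |].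
  destruct (le_lt_dec N n) as [Hn | Hn]; [| apply Hle; lia].
  apply Rle_trans with (1 := HN n Hn); simpl.
  replace (B * (q * q ^ n))%R with (q * (B * q ^ n))%R by ring.
  apply Rmult_le_compat_l; [lra | exact IH].
Qed.

Lemma subexp_mult (v w : nat -> C) :
  subexp v -> subexp w -> subexp (fun n => v n * w n).
Proof.
  intros Hv Hw q Hq.
  assert (Hs : (1 < sqrt q)%R) by (rewrite <- sqrt_1; apply sqrt_lt_1; lra).
  destruct (Hv _ Hs) as [K HK]; destruct (Hw _ Hs) as [L HL].
  exists (K * L)%R; intros n; rewrite Cmod_mult.
  replace (q ^ n)%R with (sqrt q ^ n * sqrt q ^ n)%R
    by (rewrite <- Rpow_mult_distr, sqrt_sqrt by lra; reflexivity).
  replace (K * L * (sqrt q ^ n * sqrt q ^ n))%R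
    with ((K * sqrt q ^ n) * (L * sqrt q ^ n))%R by ring.
  apply Rmult_le_compat; auto using Cmod_ge_0.
Qed.

Lemma subexp_ext (v w : nat -> C) : (forall n, v n = w n) -> subexp v -> subexp w.
Proof.
  intros E Hv q Hq; destruct (Hv q Hq) as [K HK].
  exists K; intros n; rewrite <- E; apply HK.
Qed.

Lemma nat_above (x : R) : exists N : nat, forall n, (N <= n)%nat -> (x <= INR n)%R.
Proof.
  destruct (INR_unbounded x) as [N HN]; exists N; intros n Hn.
  apply le_INR in Hn; lra.
Qed.

Lemma Cmod_add_INR_le (z : C) (n : nat) : (Cmod (z + #n) <= Cmod z + INR n)%R.
Proof.
  apply Rle_trans with (1 := Cmod_triangle _ _).
  rewrite Cmod_R, Rabs_pos_eq by apply pos_INR; lra.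
Qed.

Lemma Cmod_add_INR_ge (z : C) (n : nat) : (INR n - Cmod z <= Cmod (z + #n))%R.
Proof.
  pose proof (Cmod_triangle (z + #n) (- z)) as H.
  replace (z + #n + - z) with (#n) in H by ring.
  rewrite Cmod_opp, Cmod_R, Rabs_pos_eq in H by apply pos_INR; lra.
Qed.

Lemma Cmod_INR_S (n : nat) : Cmod (#n + 1) = (INR n + 1)%R.
Proof.
  rewrite <- RtoC_INR_S, Cmod_R, S_INR; apply Rabs_pos_eq.
  pose proof (pos_INR n); lra.
Qed.

Lemma subexp_poch_fact (a : C) : subexp (fun n => poch a n / #(fact n)).
Proof.
  apply subexp_of_ratio; intros q Hq.
  destruct (nat_above (Cmod a / (q - 1))) as [N HN].
  exists N; intros n Hn.
  rewrite poch_S, fact_C_S.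
  replace (poch a n * (a + #n) / ((#n + 1) * #(fact n)))
    with ((a + #n) / (#n + 1) * (poch a n / #(fact n)))
    by (field; auto using fact_C_neq_0, RtoC_INR_S_neq_0).
  rewrite Cmod_mult; apply Rmult_le_compat_r; [apply Cmod_ge_0 |].
  rewrite Cmod_div, Cmod_INR_S by apply RtoC_INR_S_neq_0.
  pose proof (pos_INR n).
  apply Rmult_le_reg_r with (INR n + 1)%R; [lra |].
  unfold Rdiv; rewrite Rmult_assoc, Rinv_l, Rmult_1_r by lra.
  apply Rle_trans with (1 := Cmod_add_INR_le _ _).
  apply HN in Hn.
  apply (Rmult_le_compat_r (q - 1)) in Hn; [| lra].
  unfold Rdiv in Hn; rewrite Rmult_assoc, Rinv_l, Rmult_1_r in Hn by lra.
  nra.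
Qed.

(** A recurrence without division, so that it covers both n! / (c)_n and n! / Gamma(c + n), the
    latter also at the poles. *)
Lemma subexp_fact_over (w : nat -> C) (c : C) :
  (forall n, (c + #n) * w (S n) = (#n + 1) * w n) -> subexp w.
Proof.
  intros Hw; apply subexp_of_ratio; intros q Hq.
  (* Beyond this threshold q (n - |c|) >= n + 1. *)
  destruct (nat_above ((q * Cmod c + 1) / (q - 1))) as [N HN].
  exists N; intros n Hn.
  pose proof (pos_INR n); pose proof (Cmod_ge_0 c).
  apply HN in Hn.
  apply (Rmult_le_compat_r (q - 1)) in Hn; [| lra].
  unfold Rdiv in Hn; rewrite Rmult_assoc, Rinv_l, Rmult_1_r in Hn by lra.
  pose proof (Cmod_add_INR_ge c n) as Hge.
  apply Rmult_le_reg_l with (INR n + 1)%R; [lra |].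
  assert (E : (q * ((INR n + 1) * Cmod (w n)) = q * (Cmod (c + #n) * Cmod (w (S n))))%R).
  { rewrite <- Cmod_INR_S, <- !Cmod_mult, Hw; reflexivity. }
  replace ((INR n + 1) * (q * Cmod (w n)))%R
    with (q * ((INR n + 1) * Cmod (w n)))%R by ring.
  rewrite E, <- Rmult_assoc.
  apply Rmult_le_compat_r; [apply Cmod_ge_0 | nra].
Qed.

Lemma subexp_fact_poch (c : C) : good c -> subexp (fun n => #(fact n) / poch c n).
Proof.
  intros Hc; apply (subexp_fact_over _ c); intros n.
  rewrite fact_C_S, poch_S; field; auto using poch_neq_0, good_add_neq_0.
Qed.

Lemma subexp_half_bound (w : nat -> C) : subexp w ->
  exists K, forall n, (Cmod (w n * (/ 2) ^ n) <= K * (3 / 4) ^ n)%R.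
Proof.
  intros Hw; destruct (Hw (3 / 2)%R) as [K HK]; [lra |].
  exists K; intros n.
  rewrite Cmod_mult, Cmod_pow, <- RtoC_inv, Cmod_R, Rabs_pos_eq by lra.
  replace (3 / 4)%R with (3 / 2 * / 2)%R by field.
  rewrite Rpow_mult_distr, <- Rmult_assoc.
  apply Rmult_le_compat_r; [apply pow_le; lra | apply HK].
Qed.

Lemma is_series_half (w : nat -> C) : subexp w ->
  is_series (fun n => w n * (/ 2) ^ n) (CSeries (fun n => w n * (/ 2) ^ n)).
Proof.
  intros Hw; destruct (subexp_half_bound w Hw) as [K HK].
  apply (is_series_CSeries _ K (3 / 4)); [lra | exact HK].
Qed.

(** * The complex exponential *)

Lemma cexp_plus (z w : C) : cexp (z + w) = cexp z * cexp w.
Proof.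
  destruct z as [x y]; destruct w as [x' y']; unfold cexp; simpl.
  rewrite exp_plus, cos_plus, sin_plus.
  apply injective_projections; simpl; ring.
Qed.

Lemma cexp_RtoC (x : R) : cexp (RtoC x) = RtoC (exp x).
Proof.
  unfold cexp; rewrite re_RtoC, im_RtoC, cos_0, sin_0.
  apply injective_projections; simpl; ring.
Qed.

Lemma cpow_plus (a : R) (z w : C) : cpow a (z + w) = cpow a z * cpow a w.
Proof.
  unfold cpow; rewrite <- cexp_plus; f_equal; ring.
Qed.

Lemma cpow_base_mult (a b : R) (z : C) : (0 < a)%R -> (0 < b)%R ->
  cpow (a * b) z = cpow a z * cpow b z.
Proof.
  intros Ha Hb; unfold cpow.
  rewrite ln_mult, RtoC_plus, <- cexp_plus by assumption; f_equal; ring.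
Qed.

Lemma cpow_1 (a : R) : (0 < a)%R -> cpow a 1 = RtoC a.
Proof.
  intros Ha; unfold cpow.
  rewrite Cmult_1_l, cexp_RtoC, exp_ln by exact Ha; reflexivity.
Qed.

Lemma cpow_0 (a : R) : cpow a 0 = 1.
Proof. unfold cpow; rewrite Cmult_0_l, cexp_RtoC, exp_0; reflexivity. Qed.

Lemma cpow_mult_opp (a : R) (z : C) : cpow a z * cpow a (- z) = 1.
Proof.
  rewrite <- cpow_plus; replace (z + - z) with (RtoC 0) by ring; apply cpow_0.
Qed.

Lemma cpow_neq_0 (a : R) (z : C) : cpow a z <> 0.
Proof.
  intros H; apply C1_nz; rewrite <- (cpow_mult_opp a z), H; ring.
Qed.

Lemma cpow_S (a : R) (z : C) : (0 < a)%R -> cpow a (z + 1) = RtoC a * cpow a z.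
Proof. intros Ha; rewrite cpow_plus, cpow_1 by exact Ha; ring. Qed.

Lemma sin_sqr_le (t : R) : ((sin t) ^ 2 <= t ^ 2)%R.
Proof.
  assert (H : forall x, (0 <= x)%R -> (- x <= sin x <= x)%R).
  { intros x Hx; destruct (Req_dec x 0) as [-> | Hx0]; [rewrite sin_0; lra |].
    split; [| left; apply sin_lt_x; lra].
    destruct (Rle_lt_dec 1 x) as [H1 | H1]; [pose proof (SIN_bound x); lra |].
    apply Rle_trans with 0%R; [lra |].
    apply sin_ge_0; [lra |]; pose proof PI2_1; lra. }
  destruct (Rle_lt_dec 0 t) as [Ht | Ht].
  - specialize (H t Ht); nra.
  - specialize (H (- t)%R); rewrite sin_neg in H; nra.
Qed.

Lemma cos_minus_1_bound (y : R) : (0 <= 1 - cos y <= y ^ 2 / 2)%R.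
Proof.
  split; [pose proof (COS_bound y); lra |].
  replace y with (2 * (y / 2))%R at 1 by field.
  rewrite cos_2a_sin; pose proof (sin_sqr_le (y / 2)); nra.
Qed.

Lemma sin_minus_id_bound (y : R) : (Rabs y <= 1)%R -> (Rabs (sin y - y) <= y ^ 2)%R.
Proof.
  intros Hy.
  destruct (MVT_gen (fun x => sin x - x)%R 0 y (fun x => cos x - 1)%R)
    as [c [Hc E]].
  - intros x _; auto_derive; [trivial | ring].
  - intros x _; apply derivable_continuous_pt.
    apply derivable_pt_minus; [apply derivable_pt_sin | apply derivable_pt_id].
  - rewrite sin_0 in E.
    replace (sin y - y)%R with (sin y - y - (0 - 0))%R by ring.
    rewrite E, Rminus_0_r, Rabs_mult.
    assert (Hcy : (c ^ 2 <= y ^ 2)%R).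
    { revert Hc; unfold Rmin, Rmax.
      destruct (Rle_dec 0 y); intros; nra. }
    pose proof (cos_minus_1_bound c) as Hb.
    rewrite (Rabs_left1 (cos c - 1)) by lra.
    assert (Hs : (Rabs y * Rabs y = y ^ 2)%R)
      by (rewrite <- Rabs_mult, Rabs_pos_eq; [ring | nra]).
    pose proof (Rabs_pos y); nra.
Qed.

Lemma exp_second_order (x : R) : (Rabs x <= 1 / 2)%R -> (0 <= exp x - 1 - x <= 2 * x ^ 2)%R.
Proof.
  intros Hx; apply Rabs_le_between in Hx.
  pose proof (exp_ineq1_le x) as H1; pose proof (exp_ineq1_le (- x)) as H2.
  split; [lra |].
  assert (H3 : (exp x * (1 - x) <= 1)%R).
  { apply Rle_trans with (exp x * exp (- x))%R.
    - apply Rmult_le_compat_l; [left; apply exp_pos | lra].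
    - rewrite <- exp_plus; replace (x + - x)%R with 0%R by ring; rewrite exp_0; lra. }
  pose proof (exp_pos x); nra.
Qed.

Lemma Cmod_le_Rabs (z : C) : (Cmod z <= Rabs (Re z) + Rabs (Im z))%R.
Proof.
  unfold Cmod; fold (Re z) (Im z).
  pose proof (Rabs_pos (Re z)); pose proof (Rabs_pos (Im z)).
  apply Rsqr_incr_0_var; [| lra].
  rewrite Rsqr_sqrt by (apply Rplus_le_le_0_compat; apply pow2_ge_0).
  rewrite <- (pow2_abs (Re z)), <- (pow2_abs (Im z)); unfold Rsqr; nra.
Qed.

(** This second-order error makes the relative steps of the Gauss sequence of order 1/n^2. Real and
    imaginary parts are bounded separately. *)
Lemma cexp_second_order (w : C) : (Cmod w <= 1 / 2)%R ->
  (Cmod (cexp w - 1 - w) <= 4 * Cmod w ^ 2)%R.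
Proof.
  intros Hw; apply Rle_trans with (1 := Cmod_le_Rabs _).
  pose proof (re_le_Cmod w) as Hx; pose proof (Im_le_Cmod w) as Hy.
  rewrite Cmod2_alt; destruct w as [x y]; simpl Re in *; simpl Im in *.
  unfold cexp; simpl.
  destruct (exp_second_order x) as [E1 E2]; [lra |].
  pose proof (cos_minus_1_bound y) as [C1 C2].
  pose proof (sin_minus_id_bound y ltac:(lra)) as S1.
  assert (Hx2 : (Rabs x * Rabs x = x ^ 2)%R)
    by (rewrite <- Rabs_mult, Rabs_pos_eq; [ring | nra]).
  assert (Hy2 : (Rabs y * Rabs y = y ^ 2)%R)
    by (rewrite <- Rabs_mult, Rabs_pos_eq; [ring | nra]).
  assert (Hx3 : (Rabs x <= 1 / 2)%R) by lra.
  assert (Hy3 : (Rabs y <= 1 / 2)%R) by lra.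
  pose proof (Rabs_pos x); pose proof (Rabs_pos y).
  assert (Hx4 : (- Rabs x <= x <= Rabs x)%R) by (apply Rabs_le_between; lra).
  assert (E3 : (Rabs (exp x - 1) <= 2 * Rabs x)%R).
  { apply Rabs_le_between; split; nra. }
  assert (E4 : (exp x <= 2)%R) by nra.
  assert (HR : (Rabs (exp x * cos y - 0 * sin y + - (1) + - x)
                <= 2 * x ^ 2 + y ^ 2)%R).
  { replace (exp x * cos y - 0 * sin y + - (1) + - x)%R
      with ((exp x - 1 - x) - exp x * (1 - cos y))%R by ring.
    pose proof (exp_pos x).
    apply Rabs_le_between; split; nra. }
  assert (HI : (Rabs (exp x * sin y + 0 * cos y + - 0 + - y)
                <= 2 * y ^ 2 + 2 * (Rabs x * Rabs y))%R).
  { replace (exp x * sin y + 0 * cos y + - 0 + - y)%R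
      with (exp x * (sin y - y) + y * (exp x - 1))%R by ring.
    apply Rle_trans with (1 := Rabs_triang _ _).
    rewrite !Rabs_mult, (Rabs_pos_eq (exp x)) by (left; apply exp_pos).
    pose proof (Rabs_pos (sin y - y)); pose proof (exp_pos x).
    apply Rplus_le_compat; nra. }
  apply Rle_trans with (1 := Rplus_le_compat _ _ _ _ HR HI); nra.
Qed.

(** * The Gamma function *)

(** Relative steps of order 1/n^2 keep the sequence bounded, since the product of the growth factors
    converges; its increments are then dominated by a telescoping series. *)
Lemma Clim_of_small_steps (p : nat -> C) (K : R) (N : nat) :
  (1 <= N)%nat -> (0 <= K)%R ->
  (forall n, (N <= n)%nat ->
     Cmod (p (S n) - p n) <= K / (INR n * INR (S n)) * Cmod (p n))%R ->
  exists l, Clim p l.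
Proof.
  intros HN HK Hp.
  assert (Hpos : forall n, (N <= n)%nat -> (0 < INR n)%R)
    by (intros n Hn; apply lt_0_INR; lia).
  pose (M := (Cmod (p N) * exp (K / INR N))%R).
  (* [|p n| exp (K / n)] is nonincreasing, since [K/n - K/(n+1) = K/(n(n+1))]. *)
  assert (HM : forall k, (Cmod (p (N + k)%nat) * exp (K / INR (N + k)) <= M)%R).
  { induction k as [| k IH]; [rewrite Nat.add_0_r; apply Rle_refl |].
    apply Rle_trans with (2 := IH); rewrite Nat.add_succ_r.
    set (n := (N + k)%nat) in *.
    assert (Hn : (N <= n)%nat) by (unfold n; lia).
    pose proof (Hpos n Hn) as H1; pose proof (Hpos (S n) ltac:(lia)) as H2.
    assert (E : exp (K / INR n)
                = (exp (K / INR (S n)) * exp (K / (INR n * INR (S n))))%R).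
    { rewrite <- exp_plus; f_equal.
      rewrite S_INR in *; field; lra. }
    rewrite E, Rmult_comm, <- (Rmult_assoc (Cmod (p n))), (Rmult_comm (Cmod (p n))).
    rewrite Rmult_assoc; apply Rmult_le_compat_l; [left; apply exp_pos |].
    replace (p (S n)) with (p n + (p (S n) - p n)) by ring.
    apply Rle_trans with (1 := Cmod_triangle _ _).
    apply Rle_trans with (Cmod (p n) * (1 + K / (INR n * INR (S n))))%R.
    - pose proof (Hp n Hn); lra.
    - apply Rmult_le_compat_l; [apply Cmod_ge_0 | apply exp_ineq1_le]. }
  assert (HMb : forall k, (Cmod (p (N + k)%nat) <= M)%R).
  { intros k; apply Rle_trans with (2 := HM k).
    rewrite <- (Rmult_1_r (Cmod _)) at 1.
    apply Rmult_le_compat_l; [apply Cmod_ge_0 |].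
    rewrite <- exp_0.
    destruct (Rle_lt_or_eq_dec 0 (K / INR (N + k))) as [Hlt | Heq].
    - apply Rmult_le_pos; [exact HK | left; apply Rinv_0_lt_compat, Hpos; lia].
    - left; now apply exp_increasing.
    - rewrite <- Heq; apply Rle_refl. }
  pose (b := fun k => (M * K * (/ INR (N + k) - / INR (S (N + k))))%R).
  assert (Hb : ex_series b).
  { exists (M * K * (/ INR N))%R.
    apply (is_series_scal_l (V := R_NormedModule) (M * K)%R
             (fun k => / INR (N + k) - / INR (S (N + k)))%R).
    assert (Hs : forall k, sum_n (fun k => / INR (N + k) - / INR (S (N + k)))%R k
                 = (/ INR N - / INR (S (N + k)))%R).
    { induction k as [| k IH]; [rewrite sum_O, Nat.add_0_r; reflexivity |].
      rewrite sum_Sn, IH, Nat.add_succ_r; unfold plus; simpl; ring. }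
    change (is_lim_seq
      (sum_n (fun k => / INR (N + k) - / INR (S (N + k)))%R) (/ INR N)%R).
    apply (is_lim_seq_ext (fun k => / INR N - / INR (S (N + k)))%R);
      [intros k; symmetry; apply Hs |].
    replace (Finite (/ INR N)) with (Finite (/ INR N - 0)) by (f_equal; ring).
    apply is_lim_seq_minus'; [apply is_lim_seq_const |].
    replace (Finite 0) with (Rbar_inv p_infty) by reflexivity.
    apply is_lim_seq_inv; [| discriminate].
    apply (is_lim_seq_subseq INR _ (fun k => S (N + k)) ); [| apply is_lim_seq_INR].
    intros Q [n0 Hn0]; exists n0; intros n Hn; apply Hn0; lia. }
  assert (Ha : ex_series (fun k => p (S (N + k)) - p (N + k)%nat)).
  { apply (ex_series_le (V := C_CompleteNormedModule)) with (2 := Hb).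
    intros k; change (Cmod (p (S (N + k)) - p (N + k)%nat) <= b k)%R.
    apply Rle_trans with (1 := Hp (N + k)%nat ltac:(lia)); unfold b.
    pose proof (Hpos (N + k)%nat ltac:(lia)) as H1.
    pose proof (Hpos (S (N + k)) ltac:(lia)) as H2.
    replace (/ INR (N + k) - / INR (S (N + k)))%R
      with (/ (INR (N + k) * INR (S (N + k))))%R
      by (rewrite S_INR in *; field; lra).
    unfold Rdiv.
    replace (M * K * / (INR (N + k) * INR (S (N + k))))%R
      with (K * / (INR (N + k) * INR (S (N + k))) * M)%R by ring.
    apply Rmult_le_compat_l; [| apply HMb].
    apply Rmult_le_pos; [exact HK |].
    left; apply Rinv_0_lt_compat, Rmult_lt_0_compat; assumption. }
  destruct Ha as [l Hl]; apply is_series_Clim in Hl.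
  exists (l + p N).
  assert (Hc : Clim (fun k => p (k + S N)%nat) (l + p N)).
  { apply Clim_ext with (fun k => sum_n (fun k => p (S (N + k)) - p (N + k)%nat) k + p N).
    - intros k; replace (k + S N)%nat with (S (N + k)) by lia.
      induction k as [| k IH].
      + rewrite csum_0, Nat.add_0_r; cring.
      + rewrite csum_S, !Nat.add_succ_r, <- IH; cring.
    - apply Clim_plus; [exact Hl | apply Clim_const]. }
  destruct Hc as [H1 H2]; split.
  - now apply is_lim_seq_incr_n with (S N).
  - now apply is_lim_seq_incr_n with (S N).
Qed.

Lemma ln_step_bound (n : nat) : (1 <= n)%nat ->
  (/ (INR n + 1) <= ln (INR n + 1) - ln (INR n) <= / INR n)%R.
Proof.
  intros Hn; assert (H : (0 < INR n)%R) by (apply lt_0_INR; lia).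
  set (L := (ln (INR n + 1) - ln (INR n))%R).
  assert (E : exp L = ((INR n + 1) * / INR n)%R).
  { unfold L, Rminus; rewrite exp_plus, exp_Ropp, !exp_ln by lra; reflexivity. }
  pose proof (exp_ineq1_le L) as H1; pose proof (exp_ineq1_le (- L)) as H2.
  rewrite exp_Ropp, E in H2; rewrite E in H1.
  split.
  - replace (/ ((INR n + 1) * / INR n))%R with (1 - / (INR n + 1))%R in H2
      by (field; lra).
    lra.
  - replace ((INR n + 1) * / INR n)%R with (1 + / INR n)%R in H1 by (field; lra).
    lra.
Qed.

(** The quotient of consecutive terms is e^(z L) (n + 1) / (z + n + 1) with L = ln((n + 1) / n).
    Subtracting 1 leaves a numerator arranged in two parts, each of order 1/n. *)
Lemma gauss_seq_step (z : C) (n : nat) : good z -> (1 <= n)%nat ->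
  gauss_seq z (S n) - gauss_seq z n
  = (((#n + 1) * (cexp (z * RtoC (ln (INR n + 1) - ln (INR n))) - 1
        - z * RtoC (ln (INR n + 1) - ln (INR n)))
      + z * RtoC ((INR n + 1) * (ln (INR n + 1) - ln (INR n)) - 1))
     / (z + #(S n))) * gauss_seq z n.
Proof.
  intros Hz Hn; unfold gauss_seq, cpow.
  replace (z * RtoC (ln (INR (S n))))
    with (z * RtoC (ln (INR n + 1) - ln (INR n)) + z * RtoC (ln (INR n)))
    by (rewrite S_INR, RtoC_minus; ring).
  rewrite cexp_plus, fact_C_S, (poch_S z (S n)).
  set (L := (ln (INR n + 1) - ln (INR n))%R).
  rewrite RtoC_minus, RtoC_mult, RtoC_plus.
  rewrite RtoC_INR_S.
  pose proof (good_add_neq_0 z (S n) Hz) as H1; rewrite RtoC_INR_S in H1.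
  field; split; [now apply poch_neq_0 | exact H1].
Qed.

Lemma gauss_seq_small_steps (z : C) : good z ->
  exists K N, (1 <= N)%nat /\ (0 <= K)%R /\ forall n, (N <= n)%nat ->
    (Cmod (gauss_seq z (S n) - gauss_seq z n)
     <= K / (INR n * INR (S n)) * Cmod (gauss_seq z n))%R.
Proof.
  intros Hz.
  (* n >= 2 |z| gives |z L| <= 1/2, the range of [cexp_second_order], and |z + n + 1| >= (n + 1) /
     2. The constant 16 is 4 from that lemma, times 2 from the halved denominator, times 2 from n +
     1 <= 2 n. *)
  destruct (nat_above (2 * Cmod z)) as [N HN].
  exists (16 * Cmod z ^ 2 + 2 * Cmod z)%R, (S N).
  pose proof (Cmod_ge_0 z) as Hz0.
  split; [lia |]; split; [nra |].
  intros n Hn.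
  rewrite gauss_seq_step by (assumption || lia).
  rewrite Cmod_mult; apply Rmult_le_compat_r; [apply Cmod_ge_0 |].
  assert (Hn0 : (1 <= INR n)%R) by (change 1%R with (INR 1); apply le_INR; lia).
  specialize (HN n ltac:(lia)).
  destruct (ln_step_bound n ltac:(lia)) as [L1 L2].
  set (L := (ln (INR n + 1) - ln (INR n))%R) in *.
  assert (HL0 : (0 <= L)%R).
  { apply Rle_trans with (2 := L1); left; apply Rinv_0_lt_compat; lra. }
  rewrite Cmod_div by now apply good_add_neq_0.
  assert (Hden : ((INR n + 1) / 2 <= Cmod (z + #(S n)))%R).
  { pose proof (Cmod_add_INR_ge z (S n)); pose proof (S_INR n); lra. }
  assert (Hw : (Cmod (z * RtoC L) <= Cmod z / INR n)%R).
  { rewrite Cmod_mult, Cmod_R, (Rabs_pos_eq L HL0).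
    apply Rmult_le_compat_l; assumption. }
  assert (Hw2 : (Cmod z / INR n <= 1 / 2)%R).
  { apply Rmult_le_reg_r with (INR n); [lra |].
    unfold Rdiv; rewrite Rmult_assoc, Rinv_l by lra; lra. }
  pose proof (cexp_second_order (z * RtoC L) ltac:(lra)) as He.
  assert (He2 : (Cmod (cexp (z * L) - 1 - z * L) <= 4 * (Cmod z / INR n) ^ 2)%R).
  { apply Rle_trans with (1 := He).
    pose proof (Cmod_ge_0 (z * L)); nra. }
  assert (HL3 : (Cmod (z * RtoC ((INR n + 1) * L - 1)) <= Cmod z * / INR n)%R).
  { rewrite Cmod_mult, Cmod_R.
    apply Rmult_le_compat_l; [exact Hz0 |].
    apply (Rmult_le_compat_l (INR n + 1)) in L1, L2; try lra.
    rewrite Rinv_r in L1 by lra.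
    replace ((INR n + 1) * / INR n)%R with (1 + / INR n)%R in L2 by (field; lra).
    rewrite Rabs_pos_eq; lra. }
  assert (Hnum : (Cmod ((#n + 1) * (cexp (z * L) - 1 - z * L)
                     + z * RtoC ((INR n + 1) * L - 1))
     <= (INR n + 1) * (4 * (Cmod z / INR n) ^ 2) + Cmod z * / INR n)%R).
  { apply Rle_trans with (1 := Cmod_triangle _ _).
    apply Rplus_le_compat; [| exact HL3].
    rewrite Cmod_mult, Cmod_INR_S.
    apply Rmult_le_compat_l; [lra | exact He2]. }
  apply Rle_trans with
    (((INR n + 1) * (4 * (Cmod z / INR n) ^ 2) + Cmod z * / INR n)
     * / ((INR n + 1) / 2))%R.
  - apply Rmult_le_compat; [apply Cmod_ge_0 | | exact Hnum |].
    + left; apply Rinv_0_lt_compat; lra.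
    + apply Rinv_le_contravar; lra.
  - rewrite S_INR.
    apply Rmult_le_reg_r with (INR n * INR n * (INR n + 1))%R.
    { apply Rmult_lt_0_compat; [apply Rmult_lt_0_compat |]; lra. }
    replace (((INR n + 1) * (4 * (Cmod z / INR n) ^ 2) + Cmod z * / INR n)
     * / ((INR n + 1) / 2) * (INR n * INR n * (INR n + 1)))%R
      with (8 * Cmod z ^ 2 * (INR n + 1) + 2 * Cmod z * INR n)%R by (field; lra).
    replace ((16 * Cmod z ^ 2 + 2 * Cmod z) / (INR n * (INR n + 1))
      * (INR n * INR n * (INR n + 1)))%R
      with ((16 * Cmod z ^ 2 + 2 * Cmod z) * INR n)%R by (field; lra).
    pose proof (pow2_ge_0 (Cmod z)); nra.
Qed.

Lemma gauss_seq_neq_0 (z : C) (n : nat) : good z -> gauss_seq z n <> 0.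
Proof.
  intros Hz; unfold gauss_seq, Cdiv.
  apply Cmult_neq_0; [apply Cmult_neq_0 |].
  - apply cpow_neq_0.
  - apply fact_C_neq_0.
  - now apply Cinv_neq_0, poch_neq_0.
Qed.

(* The inverses of a nonvanishing sequence with small relative steps again have
   small relative steps, which rules out a zero limit. *)
Lemma gauss_seq_Clim (z : C) : good z -> exists l : C, l <> 0 /\ Clim (gauss_seq z) l.
Proof.
  intros Hz.
  destruct (gauss_seq_small_steps z Hz) as [K [N [HN [HK Hs]]]].
  destruct (Clim_of_small_steps _ K N HN HK Hs) as [l Hl].
  exists l; split; [| exact Hl].
  (* From here on the relative step is at most 1/2, so |p| <= 2 |p'|; this is the factor 2 lost in
     passing to inverses. *)
  destruct (nat_above (2 * K)) as [N' HN'].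
  destruct (Clim_of_small_steps (fun n => / gauss_seq z n) (2 * K) (N + N'))
    as [l' Hl']; [lia | lra | |].
  - intros n Hn.
    specialize (Hs n ltac:(lia)); specialize (HN' n ltac:(lia)).
    assert (Hn0 : (1 <= INR n)%R) by (change 1%R with (INR 1); apply le_INR; lia).
    pose proof (gauss_seq_neq_0 z n Hz) as H0.
    pose proof (gauss_seq_neq_0 z (S n) Hz) as H1.
    set (p := gauss_seq z n) in *; set (p' := gauss_seq z (S n)) in *.
    set (e := (K / (INR n * INR (S n)))%R) in *.
    assert (He : (e <= / 2)%R).
    { unfold e; rewrite S_INR.
      apply Rmult_le_reg_r with (INR n * (INR n + 1))%R; [nra |].
      unfold Rdiv; rewrite Rmult_assoc, Rinv_l by nra; nra. }
    assert (He0 : (0 <= e)%R).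
    { unfold e; apply Rmult_le_pos; [exact HK |].
      left; apply Rinv_0_lt_compat; rewrite S_INR; nra. }
    replace (/ p' - / p) with (- (p' - p) * (/ p' * / p)) by (field; auto).
    replace (2 * K / (INR n * INR (S n)))%R with (2 * e)%R
      by (unfold e, Rdiv; ring).
    rewrite !Cmod_mult, Cmod_opp, !Cmod_inv by assumption.
    apply Cmod_gt_0 in H0; apply Cmod_gt_0 in H1.
    rewrite <- Rmult_assoc; apply Rmult_le_compat_r;
      [left; now apply Rinv_0_lt_compat |].
    apply Rmult_le_reg_r with (Cmod p'); [exact H1 |].
    rewrite Rmult_assoc, Rinv_l, Rmult_1_r by lra.
    pose proof (Cmod_triangle p' (- (p' - p))) as Ht.
    replace (p' + - (p' - p)) with p in Ht by ring.
    rewrite Cmod_opp in Ht.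
    assert (Hpp : (Cmod p <= 2 * Cmod p')%R) by nra.
    nra.
  - intros Hl0; apply C1_nz.
    apply (Clim_unique (fun n => gauss_seq z n * / gauss_seq z n)).
    + apply Clim_ext with (fun _ => RtoC 1); [| apply Clim_const].
      intros n; symmetry; now apply Cinv_r, gauss_seq_neq_0.
    + replace (RtoC 0) with (l * l') by (rewrite Hl0; ring).
      now apply Clim_mult.
Qed.

Lemma Gamma_of_Clim (z l : C) : Clim (gauss_seq z) l -> Gamma z = l.
Proof.
  intros [H1 H2]; unfold Gamma.
  rewrite (is_lim_seq_unique _ _ H1), (is_lim_seq_unique _ _ H2).
  now destruct l.
Qed.

Lemma Gamma_Clim (z : C) : good z -> Clim (gauss_seq z) (Gamma z).
Proof.
  intros Hz; destruct (gauss_seq_Clim z Hz) as [l [_ Hl]].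
  now rewrite (Gamma_of_Clim z l Hl).
Qed.

Lemma Gamma_neq_0 (z : C) : good z -> Gamma z <> 0.
Proof.
  intros Hz; destruct (gauss_seq_Clim z Hz) as [l [Hl0 Hl]].
  now rewrite (Gamma_of_Clim z l Hl).
Qed.

(** For n >= k the Pochhammer symbol in [gauss_seq] contains a zero factor, and division by zero
    gives 0. Hence [/ Gamma z] takes the true value 0 of 1/Gamma at the poles. *)
Lemma Gamma_nonpos_int (z : C) : nonpos_int z -> Gamma z = 0.
Proof.
  intros [k ->]; apply Gamma_of_Clim.
  apply Clim_ext_loc with (u := fun _ => RtoC 0) (N := k); [| apply Clim_const].
  intros n Hn; unfold gauss_seq.
  replace (S n) with (S k + (n - k))%nat by lia.
  rewrite poch_add, poch_S, RtoC_opp.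
  replace (- #k + #k) with (RtoC 0) by ring.
  unfold Cdiv; rewrite Cmult_0_r, Cmult_0_l, Cinv_0; ring.
Qed.

Lemma Clim_ratio_shift (z : C) : Clim (fun n => #n / (z + #n)) 1.
Proof.
  destruct (nat_above (2 * Cmod z + 1)) as [N HN].
  assert (H : Clim (fun n => 1 + - z / (z + #n)) (1 + 0)).
  { apply Clim_plus; [apply Clim_const |].
    assert (H : Clim (fun k => - z / (z + #(k + N))) 0).
    { apply Clim_of_Cmod with (fun k => Cmod z * 2 * / INR (S k))%R.
      - intros k; specialize (HN (k + N)%nat ltac:(lia)).
        pose proof (Cmod_ge_0 z) as Hz0; pose proof (pos_INR k).
        assert (Hk : (INR (S k) / 2 <= Cmod (z + #(k + N)))%R).
        { pose proof (Cmod_add_INR_ge z (k + N)) as Hge.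
          assert (INR k <= INR (k + N))%R by (apply le_INR; lia).
          rewrite S_INR; lra. }
        rewrite S_INR in *.
        replace (- z / (z + #(k + N)) - 0) with (- z / (z + #(k + N))) by ring.
        rewrite Cmod_div, Cmod_opp.
        + unfold Rdiv; rewrite Rmult_assoc.
          apply Rmult_le_compat_l; [exact Hz0 |].
          replace (2 * / (INR k + 1))%R with (/ ((INR k + 1) / 2))%R by (field; lra).
          apply Rinv_le_contravar; lra.
        + apply Cmod_gt_0; lra.
      - replace (Finite 0) with (Finite (Cmod z * 2 * 0)) by (f_equal; ring).
        apply is_lim_seq_mult'; [apply is_lim_seq_const |].
        replace (Finite 0) with (Rbar_inv p_infty) by reflexivity.
        apply is_lim_seq_inv; [| discriminate].
        apply is_lim_seq_incr_1 with (u := INR), is_lim_seq_INR. }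
    destruct H as [H1 H2]; split.
    - now apply is_lim_seq_incr_n with N.
    - now apply is_lim_seq_incr_n with N. }
  rewrite Cplus_0_r in H; apply Clim_ext_loc with (N := N) (2 := H).
  intros n Hn; specialize (HN n Hn).
  pose proof (Cmod_add_INR_ge z n); pose proof (Cmod_ge_0 z).
  field; apply Cmod_gt_0; lra.
Qed.

(** For n >= 1 the Gauss sequences at z + 1 and z differ by the factor z n / (z + 1 + n), which
    tends to z. *)
Lemma Gamma_S (z : C) : good z -> Gamma (z + 1) = z * Gamma z.
Proof.
  intros Hz; apply Gamma_of_Clim.
  replace (z * Gamma z) with (1 * (z * Gamma z)) by ring.
  apply Clim_ext_loc with
    (u := fun n => (#n / (z + 1 + #n)) * (z * gauss_seq z n)) (N := 1%nat).
  - intros n Hn; unfold gauss_seq.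
    rewrite cpow_S by (apply lt_0_INR; lia).
    assert (E : poch z (S n) * (z + 1 + #n) = z * poch (z + 1) (S n)).
    { rewrite <- poch_S_l, (poch_S z (S n)), RtoC_INR_S; ring. }
    pose proof (poch_neq_0 _ (S n) Hz).
    pose proof (poch_neq_0 _ (S n) (good_S _ Hz)).
    pose proof (good_add_neq_0 _ n (good_S _ Hz)).
    pose proof (good_neq_0 _ Hz).
    transitivity (#n * (z * (cpow (INR n) z * #(fact n)))
                  / (poch z (S n) * (z + 1 + #n))).
    + field; auto.
    + rewrite E; field; auto.
  - apply Clim_mult; [apply Clim_ratio_shift |].
    apply Clim_mult; [apply Clim_const | now apply Gamma_Clim].
Qed.

Lemma Gamma_add (z : C) (n : nat) : good z -> Gamma (z + #n) = poch z n * Gamma z.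
Proof.
  intros Hz; induction n as [| n IH].
  - simpl; replace (z + 0) with z by ring; ring.
  - rewrite RtoC_INR_S, Cplus_assoc, Gamma_S by now apply good_add.
    rewrite IH, poch_S; ring.
Qed.

(* Valid at the poles too, where [Gamma] and its inverse take the value [0]. *)
Lemma inv_Gamma_S (z : C) : / Gamma z = z * / Gamma (z + 1).
Proof.
  destruct (classic (nonpos_int z)) as [Hz | Hz].
  - rewrite (Gamma_nonpos_int z Hz), Cinv_0.
    destruct Hz as [[| k] ->]; [simpl; rewrite Ropp_0; ring |].
    rewrite (Gamma_nonpos_int (_ + 1)), Cinv_0; [ring |].
    exists k; rewrite S_INR, !RtoC_opp, RtoC_plus; ring.
  - rewrite Gamma_S by exact Hz.
    field; auto using Gamma_neq_0, good_neq_0.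
Qed.

(** The Gauss limit rewritten as Gamma(z + n) ~ n^(z - 1) n!, the form in which shifted Gamma values
    are compared. *)
Lemma Gamma_asymptotic (z : C) : good z ->
  Clim (fun n => Gamma (z + #n) * #n / (cpow (INR n) z * #(fact n))) 1.
Proof.
  intros Hz.
  pose proof (Gamma_neq_0 z Hz) as HG.
  apply Clim_ext with
    (fun n => (#n / (z + #n)) * (Gamma z * / gauss_seq z n)).
  - intros n; unfold gauss_seq.
    rewrite Gamma_add, poch_S by exact Hz.
    field; repeat split; auto using cpow_neq_0, fact_C_neq_0, good_add_neq_0, poch_neq_0.
  - replace (RtoC 1) with (1 * (Gamma z * / Gamma z)) by (field; exact HG).
    apply Clim_mult; [apply Clim_ratio_shift |].
    apply Clim_mult; [apply Clim_const |].
    apply Clim_inv; [exact HG | now apply Gamma_Clim].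
Qed.

(** * The binomial series at 1/2 *)

Lemma CV_radius_subexp (p : nat -> R) (w : nat -> C) (x : R) :
  subexp w -> (forall n, Rabs (p n) <= Cmod (w n))%R -> (Rabs x <= / 2)%R ->
  Rbar_lt (Rabs x) (CV_radius p).
Proof.
  intros Hw Hp Hx; destruct (Hw (4 / 3)%R) as [K HK]; [lra |].
  apply Rbar_lt_le_trans with (3 / 4)%R; [simpl; lra |].
  apply (proj1 (CV_radius_bounded p)).
  exists K; intros n.
  rewrite Rabs_mult, <- RPow_abs, (Rabs_pos_eq (3 / 4)) by lra.
  apply Rle_trans with (K * (4 / 3) ^ n * (3 / 4) ^ n)%R.
  - apply Rmult_le_compat_r; [apply pow_le; lra |].
    apply Rle_trans with (1 := Hp n), HK.
  - rewrite Rmult_assoc, <- Rpow_mult_distr.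
    replace (4 / 3 * (3 / 4))%R with 1%R by field.
    rewrite pow1; lra.
Qed.

(** Serves to split (1 - x) w' = s w into real and imaginary parts: with s = A + i B, the pair (Re,
    Im) satisfies it with -B and the pair (Im, Re) with B. *)
Lemma PSeries_first_order (p q : nat -> R) (A B x : R) :
  (forall n, INR (S n) * p (S n) = (A + INR n) * p n + B * q n)%R ->
  Rbar_lt (Rabs x) (CV_radius p) -> Rbar_lt (Rabs x) (CV_radius q) ->
  ((1 - x) * PSeries (PS_derive p) x = A * PSeries p x + B * PSeries q x)%R.
Proof.
  intros Hrec Hp Hq.
  pose proof (CV_radius_inside _ _ Hp) as Ep.
  pose proof (CV_radius_inside _ _ Hq) as Eq.
  pose proof (ex_pseries_derive _ _ Hp) as Ed.
  assert (E : PSeries (PS_derive p) x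
    = PSeries (PS_plus (PS_plus (PS_scal A p) (PS_scal B q))
                 (PS_incr_1 (PS_derive p))) x).
  { apply PSeries_ext; intros n.
    unfold PS_plus, PS_scal, PS_incr_1, PS_derive, plus, scal; simpl.
    unfold mult; simpl.
    change (INR (S n) * p (S n) = A * p n + B * q n
      + match n with 0%nat => zero | S k => (INR (S k) * p (S k)) end)%R.
    rewrite Hrec; destruct n as [| n]; [unfold zero; simpl; ring | ring]. }
  rewrite !PSeries_plus, !PSeries_scal, PSeries_incr_1 in E.
  - lra.
  - apply ex_pseries_scal; [apply Rmult_comm | exact Ep].
  - apply ex_pseries_scal; [apply Rmult_comm | exact Eq].
  - apply ex_pseries_plus; apply ex_pseries_scal;
      [apply Rmult_comm | exact Ep | apply Rmult_comm | exact Eq].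
  - now apply ex_pseries_incr_1.
Qed.

(* The series [f] satisfies [(1 - x) f' = s f], so [(1 - x)^s f] is constant. *)
Lemma binomial_series_half (s : C) :
  is_series (fun n => poch s n / #(fact n) * (/ 2) ^ n) (cpow 2 s).
Proof.
  pose (w := fun n => poch s n / #(fact n)).
  assert (Hw : subexp w) by apply subexp_poch_fact.
  pose (p := fun n => Re (w n)); pose (q := fun n => Im (w n)).
  assert (Hrec : forall n, #(S n) * w (S n) = (s + #n) * w n).
  { intros n; unfold w; rewrite poch_S, fact_C_S, RtoC_INR_S.
    field; auto using fact_C_neq_0, RtoC_INR_S_neq_0. }
  pose (A := Re s); pose (B := Im s).
  assert (Hp : forall n, (INR (S n) * p (S n) = (A + INR n) * p n + (- B) * q n)%R).
  { intros n; generalize (f_equal Re (Hrec n)); rewrite re_scal_l.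
    unfold p, q, A, B; intros ->; simpl; unfold Re, Im; simpl; ring. }
  assert (Hq : forall n, (INR (S n) * q (S n) = (A + INR n) * q n + B * p n)%R).
  { intros n; generalize (f_equal Im (Hrec n)); rewrite im_scal_l.
    unfold p, q, A, B; intros ->; simpl; unfold Re, Im; simpl; ring. }
  assert (Rp : forall x, (Rabs x <= / 2)%R -> Rbar_lt (Rabs x) (CV_radius p)).
  { intros x; apply (CV_radius_subexp p w); [exact Hw | intros n; apply re_le_Cmod]. }
  assert (Rq : forall x, (Rabs x <= / 2)%R -> Rbar_lt (Rabs x) (CV_radius q)).
  { intros x; apply (CV_radius_subexp q w); [exact Hw | intros n; apply Im_le_Cmod]. }
  pose (u := PSeries p); pose (v := PSeries q).
  assert (Du : forall x, (0 <= x <= / 2)%R ->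
            is_derive u x ((A * u x - B * v x) / (1 - x))%R).
  { intros x Hx; assert (Hax : (Rabs x <= / 2)%R) by (rewrite Rabs_pos_eq; lra).
    replace ((A * u x - B * v x) / (1 - x))%R with (PSeries (PS_derive p) x).
    - apply is_derive_PSeries, Rp, Hax.
    - pose proof (PSeries_first_order p q A (- B) x Hp (Rp x Hax) (Rq x Hax)) as E.
      apply Rmult_eq_reg_l with (1 - x)%R; [| lra].
      rewrite E; unfold u, v; field; lra. }
  assert (Dv : forall x, (0 <= x <= / 2)%R ->
            is_derive v x ((A * v x + B * u x) / (1 - x))%R).
  { intros x Hx; assert (Hax : (Rabs x <= / 2)%R) by (rewrite Rabs_pos_eq; lra).
    replace ((A * v x + B * u x) / (1 - x))%R with (PSeries (PS_derive q) x).
    - apply is_derive_PSeries, Rq, Hax.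
    - pose proof (PSeries_first_order q p A B x Hq (Rq x Hax) (Rp x Hax)) as E.
      apply Rmult_eq_reg_l with (1 - x)%R; [| lra].
      rewrite E; unfold u, v; field; lra. }
  (* [P] and [Q] are the real and imaginary parts of (1 - x)^s (u + i v). *)
  pose (P := fun x => (exp (A * ln (1 - x)) *
     (cos (B * ln (1 - x)) * u x - sin (B * ln (1 - x)) * v x))%R).
  pose (Q := fun x => (exp (A * ln (1 - x)) *
     (cos (B * ln (1 - x)) * v x + sin (B * ln (1 - x)) * u x))%R).
  assert (HP : P 0%R = P (/ 2)%R).
  { apply (eq_is_derive P); [| lra].
    intros x Hx; unfold P; pose proof (Du x Hx) as D1; pose proof (Dv x Hx) as D2.
    auto_derive.
    - repeat split; try lra; eexists; eassumption.
    - rewrite (is_derive_unique (fun y : R => u y) _ _ D1).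
      rewrite (is_derive_unique (fun y : R => v y) _ _ D2).
      unfold zero; simpl; field; lra. }
  assert (HQ : Q 0%R = Q (/ 2)%R).
  { apply (eq_is_derive Q); [| lra].
    intros x Hx; unfold Q; pose proof (Du x Hx) as D1; pose proof (Dv x Hx) as D2.
    auto_derive.
    - repeat split; try lra; eexists; eassumption.
    - rewrite (is_derive_unique (fun y : R => u y) _ _ D1).
      rewrite (is_derive_unique (fun y : R => v y) _ _ D2).
      unfold zero; simpl; field; lra. }
  assert (Hu0 : u 0%R = 1%R).
  { unfold u; rewrite PSeries_0; unfold p, w; simpl; field. }
  assert (Hv0 : v 0%R = 0%R).
  { unfold v; rewrite PSeries_0; unfold q, w; simpl; field. }
  unfold P, Q in HP, HQ.
  rewrite Rminus_0_r, ln_1, !Rmult_0_r, exp_0, cos_0, sin_0, Hu0, Hv0 in HP, HQ.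
  replace (1 - / 2)%R with (/ 2)%R in HP, HQ by field.
  rewrite ln_Rinv in HP, HQ by lra.
  assert (E : cpow 2 (- s) * (u (/ 2)%R, v (/ 2)%R) = 1).
  { unfold cpow, cexp.
    replace (- s * RtoC (ln 2)) with ((A * - ln 2)%R, (B * - ln 2)%R).
    - apply injective_projections; simpl; lra.
    - apply injective_projections; simpl; unfold A, B, Re, Im; simpl; ring. }
  assert (E2 : (u (/ 2)%R, v (/ 2)%R) = cpow 2 s).
  { replace (u (/ 2)%R, v (/ 2)%R)
      with ((cpow 2 s * cpow 2 (- s)) * (u (/ 2)%R, v (/ 2)%R))
      by (rewrite cpow_mult_opp; cring).
    rewrite <- Cmult_assoc, E; cring. }
  rewrite <- E2.
  replace (u (/ 2)%R, v (/ 2)%R) with (CSeries (fun n => w n * (/ 2) ^ n)).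
  - now apply is_series_half.
  - unfold CSeries, u, v, PSeries.
    f_equal; apply Series_ext; intros n.
    + rewrite <- RtoC_inv, <- RtoC_pow by lra; apply re_scal_r.
    + rewrite <- RtoC_inv, <- RtoC_pow by lra; apply im_scal_r.
Qed.

(** * The regularized hypergeometric series at 1/2 *)

Definition hyp_term (a b c : C) (n : nat) : C :=
  poch a n * poch b n * / Gamma (c + #n) / #(fact n) * (/ 2) ^ n.

(* 2F1(a, b; c; 1/2) / Gamma(c), which is meaningful for every [c]. *)
Definition hyp (a b c : C) : C := CSeries (hyp_term a b c).

Lemma subexp_hyp (a b c : C) :
  subexp (fun n => poch a n * poch b n * / Gamma (c + #n) / #(fact n)).
Proof.
  apply subexp_ext with (fun n =>
    (poch a n / #(fact n)) * ((poch b n / #(fact n)) * (#(fact n) * / Gamma (c + #n)))).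
  - intros n; unfold Cdiv.
    set (g := / Gamma (c + #n)); field; apply fact_C_neq_0.
  - apply subexp_mult; [apply subexp_poch_fact |].
    apply subexp_mult; [apply subexp_poch_fact |].
    apply (subexp_fact_over _ c); intros n.
    rewrite fact_C_S, (inv_Gamma_S (c + #n)), RtoC_INR_S, Cplus_assoc; ring.
Qed.

Lemma is_series_hyp (a b c : C) : is_series (hyp_term a b c) (hyp a b c).
Proof. apply (is_series_half _ (subexp_hyp a b c)). Qed.

Lemma hyp_term_good (a b c : C) (n : nat) : good c ->
  hyp_term a b c n
  = / Gamma c * (poch a n * poch b n / (poch c n * #(fact n)) * (/ 2) ^ n).
Proof.
  intros Hc; unfold hyp_term; rewrite Gamma_add by exact Hc.
  set (h := (/ 2) ^ n).
  field; auto using fact_C_neq_0, poch_neq_0, Gamma_neq_0.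
Qed.

(* Multiplication of a power series by the variable, evaluated at 1/2. *)
Definition half_shift (f : nat -> C) (n : nat) : C :=
  match n with O => 0 | S m => / 2 * f m end.

Lemma is_series_half_shift (f : nat -> C) (l : C) :
  is_series f l -> is_series (half_shift f) (/ 2 * l).
Proof.
  intros H; apply (is_Cseries_shift (fun n => / 2 * f n)); [reflexivity.. |].
  now apply is_Cseries_mult_l.
Qed.

(** Coefficientwise this is (b + 1)_n - (b)_n = n (b + 1)_{n-1}; the factor n lowers the factorial
    and shifts the index. *)
Lemma hyp_contiguous_b (a b c : C) :
  hyp a (b + 1) c = hyp a b c + a / 2 * hyp (a + 1) (b + 1) (c + 1).
Proof.
  apply (is_Cseries_unique (hyp_term a (b + 1) c)); [apply is_series_hyp |].
  apply is_Cseries_ext with (fun n => hyp_term a b c n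
    + a * half_shift (hyp_term (a + 1) (b + 1) (c + 1)) n).
  - intros [| n]; simpl half_shift; unfold hyp_term.
    + simpl; ring.
    + replace (c + 1 + #n) with (c + #(S n)) by (rewrite RtoC_INR_S; ring).
      rewrite (poch_S_l a), (poch_S_l b), (poch_S (b + 1)), fact_C_S, Cpow_S.
      set (g := / Gamma _); set (h := (/ 2) ^ n).
      field; auto using fact_C_neq_0, RtoC_INR_S_neq_0.
  - apply is_Cseries_plus; [apply is_series_hyp |].
    replace (a / 2 * hyp (a + 1) (b + 1) (c + 1))
      with (a * (/ 2 * hyp (a + 1) (b + 1) (c + 1))) by (unfold Cdiv; ring).
    apply is_Cseries_mult_l, is_series_half_shift, is_series_hyp.
Qed.

(** At a general argument x the factor [a / 2] reads a (1 - x). The proof keeps it as a - a x, the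
    form in which the relation holds coefficient by coefficient. *)
Lemma hyp_contiguous_c (a b c : C) :
  hyp a b c = a / 2 * hyp (a + 1) (b + 1) (c + 1) + (c - a) * hyp a (b + 1) (c + 1).
Proof.
  apply (is_Cseries_unique (hyp_term a b c)); [apply is_series_hyp |].
  apply is_Cseries_ext with (fun n =>
    (a * hyp_term (a + 1) (b + 1) (c + 1) n
     - a * half_shift (hyp_term (a + 1) (b + 1) (c + 1)) n)
    + (c - a) * hyp_term a (b + 1) (c + 1) n).
  - intros [| n]; simpl half_shift; unfold hyp_term.
    + replace (c + #0) with c by (simpl; ring).
      replace (c + 1 + #0) with (c + 1) by (simpl; ring).
      rewrite (inv_Gamma_S c); set (x := / Gamma _); simpl; field; exact C1_nz.
    + replace (c + 1 + #(S n)) with (c + #(S n) + 1) by ring.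
      rewrite (inv_Gamma_S (c + #(S n))).
      replace (c + 1 + #n) with (c + #(S n)) by (rewrite RtoC_INR_S; ring).
      rewrite (inv_Gamma_S (c + #(S n))).
      rewrite (poch_S_l a), (poch_S_l b), (poch_S (b + 1)), (poch_S (a + 1)).
      rewrite fact_C_S, Cpow_S.
      set (g := / Gamma _); set (h := (/ 2) ^ n); rewrite RtoC_INR_S.
      field; auto using fact_C_neq_0, RtoC_INR_S_neq_0.
  - apply is_Cseries_plus; [| apply is_Cseries_mult_l, is_series_hyp].
    replace (a / 2 * hyp (a + 1) (b + 1) (c + 1))
      with (a * hyp (a + 1) (b + 1) (c + 1)
            - a * (/ 2 * hyp (a + 1) (b + 1) (c + 1))) by field.
    apply is_Cseries_minus; apply is_Cseries_mult_l;
      [apply is_series_hyp | apply is_series_half_shift, is_series_hyp].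
Qed.

(* The hypergeometric differential equation, divided by [a b], with all
   derivatives written as contiguous series; at 1/2 the first-order term has
   coefficient [c - (a + b + 1) / 2 = 0]. *)
Lemma hyp_double_step (a b : C) :
  hyp a b ((a + b + 1) / 2)
  = (a + 1) * (b + 1) / 4 * hyp (a + 2) (b + 2) ((a + 2 + (b + 2) + 1) / 2).
Proof.
  set (c := (a + b + 1) / 2).
  replace ((a + 2 + (b + 2) + 1) / 2) with (c + 2) by (unfold c; field).
  pose (f := hyp_term (a + 2) (b + 2) (c + 2)).
  pose (g := hyp_term (a + 1) (b + 1) (c + 1)).
  apply (is_Cseries_unique (hyp_term a b c)); [apply is_series_hyp |].
  (* The two summands are x (1 - x) F'' and (c - (a + b + 1) x) F', divided by a b, with a + b + 1 =
     2 c. *)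
  apply is_Cseries_ext with (fun n =>
    ((a + 1) * (b + 1)) * (half_shift f n - half_shift (half_shift f) n)
    + (c * g n - (2 * c) * half_shift g n)).
  - intros [| [| n]]; simpl half_shift; unfold f, g, hyp_term.
    + replace (c + #0) with c by (simpl; ring).
      replace (c + 1 + #0) with (c + 1) by (simpl; ring).
      rewrite (inv_Gamma_S c); set (x := / Gamma _); simpl; field; exact C1_nz.
    + replace (c + 2 + #0) with (c + 1 + 1) by (simpl; ring).
      replace (c + 1 + #1) with (c + 1 + 1) by (simpl; ring).
      replace (c + 1 + #0) with (c + 1) by (simpl; ring).
      replace (c + #1) with (c + 1) by (simpl; ring).
      rewrite (inv_Gamma_S (c + 1)); simpl.
      set (x := / Gamma _); unfold c; field; exact C1_nz.
    + replace (c + 2 + #(S n)) with (c + #(S (S n)) + 1)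
        by (rewrite !RtoC_INR_S; ring).
      replace (c + 1 + #(S (S n))) with (c + #(S (S n)) + 1) by ring.
      replace (c + 2 + #n) with (c + #(S (S n))) by (rewrite !RtoC_INR_S; ring).
      replace (c + 1 + #(S n)) with (c + #(S (S n))) by (rewrite !RtoC_INR_S; ring).
      rewrite (inv_Gamma_S (c + #(S (S n)))).
      rewrite !(poch_S_l a), !(poch_S_l b), !(poch_S_l (a + 1)), !(poch_S_l (b + 1)).
      replace (a + 1 + 1) with (a + 2) by ring.
      replace (b + 1 + 1) with (b + 2) by ring.
      rewrite !(poch_S (a + 2)), !(poch_S (b + 2)).
      rewrite !fact_C_S, !Cpow_S.
      set (x := / Gamma _); set (h := (/ 2) ^ n); rewrite !RtoC_INR_S.
      assert (H2 : #n + 1 + 1 <> 0)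
        by (rewrite <- RtoC_INR_S; apply RtoC_INR_S_neq_0).
      unfold c; field; auto using fact_C_neq_0, RtoC_INR_S_neq_0.
  - replace ((a + 1) * (b + 1) / 4 * hyp (a + 2) (b + 2) (c + 2))
      with (((a + 1) * (b + 1)) * (/ 2 * hyp (a + 2) (b + 2) (c + 2)
              - / 2 * (/ 2 * hyp (a + 2) (b + 2) (c + 2)))
            + (c * hyp (a + 1) (b + 1) (c + 1)
               - (2 * c) * (/ 2 * hyp (a + 1) (b + 1) (c + 1)))) by field.
    apply is_Cseries_plus.
    + apply is_Cseries_mult_l, is_Cseries_minus;
        repeat apply is_series_half_shift; apply is_series_hyp.
    + apply is_Cseries_minus; apply is_Cseries_mult_l;
        [| apply is_series_half_shift]; apply is_series_hyp.
Qed.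

Lemma csum_rev (f : nat -> C) (n : nat) : sum_n f n = sum_n (fun k => f (n - k)%nat) n.
Proof.
  induction n as [| n IH]; [now rewrite !csum_0 |].
  rewrite csum_S, csum_S_l, IH, Nat.sub_0_r; apply Cplus_comm.
Qed.

(** At x = 1/2 the factor (1 - x)^(c - a - b) is 2^(a + b - c). The double series of the product
    sums by rows to the product of the values and by antidiagonals, through [saalschutz], to
    [hyp a b c]. *)
Lemma hyp_euler (a b c : C) : good c ->
  hyp a b c = cpow 2 (a + b - c) * hyp (c - a) (c - b) c.
Proof.
  intros Hc.
  pose (u := fun m => poch (a + b - c) m / #(fact m)).
  assert (Hu : subexp u) by apply subexp_poch_fact.
  pose (g := fun m => hyp (c - a) (c - b) c * (u m * (/ 2) ^ m)).
  apply (is_Cseries_unique g).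
  - destruct (subexp_half_bound u Hu) as [K HK].
    destruct (subexp_half_bound _ (subexp_hyp (c - a) (c - b) c)) as [L HL].
    apply (double_series_antidiagonal
      (fun m n => (u m * (/ 2) ^ m) * hyp_term (c - a) (c - b) c n)
      g _ (K * L) (3 / 4)); [lra | | |].
    + intros m n; rewrite Cmod_mult, pow_add.
      replace (K * L * ((3 / 4) ^ m * (3 / 4) ^ n))%R
        with ((K * (3 / 4) ^ m) * (L * (3 / 4) ^ n))%R by ring.
      apply Rmult_le_compat; auto using Cmod_ge_0; apply HL.
    + intros m; unfold g; rewrite (Cmult_comm (hyp _ _ _)).
      apply is_Cseries_mult_l, is_series_hyp.
    + apply is_Cseries_ext with (2 := is_series_hyp a b c); intros N.
      rewrite csum_rev, hyp_term_good, <- saalschutz by exact Hc.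
      set (h := (/ 2) ^ N).
      transitivity ((/ Gamma c * h) * sum_n (fun n =>
        poch (a + b - c) (N - n) / #(fact (N - n))
        * (poch (c - a) n * poch (c - b) n / (poch c n * #(fact n)))) N); [cring |].
      rewrite <- csum_mult_l; apply csum_ext; intros n Hn.
      replace (N - (N - n))%nat with n by lia.
      rewrite hyp_term_good by exact Hc; unfold u.
      replace h with ((/ 2) ^ (N - n) * (/ 2) ^ n)
        by (rewrite <- Cpow_add_r; unfold h; f_equal; lia).
      unfold Cdiv; ring.
  - unfold g; rewrite (Cmult_comm (cpow _ _)).
    apply is_Cseries_mult_l, binomial_series_half.
Qed.

(** The factor at index 0 is at least Re c, the later ones at least Re c + k >= k + 1; keeping Re c
    apart yields the decay in 1 / Re c below. *)
Lemma Cmod_poch_ge (c : C) (n : nat) : (1 <= Re c)%R ->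
  (Re c * INR (fact (S n)) <= Cmod (poch c (S n)))%R.
Proof.
  intros Hc.
  assert (Hf : forall k, (Re c + INR k <= Cmod (c + #k))%R).
  { intros k; apply Rle_trans with (2 := re_le_Cmod _).
    apply Rle_trans with (2 := Rle_abs _); simpl; unfold Re; lra. }
  induction n as [| n IH].
  - rewrite poch_S, Cmod_mult; simpl poch; rewrite Cmod_1.
    specialize (Hf 0%nat); simpl in *; lra.
  - rewrite poch_S, Cmod_mult, fact_simpl, mult_INR.
    replace (Re c * (INR (S (S n)) * INR (fact (S n))))%R
      with ((Re c * INR (fact (S n))) * INR (S (S n)))%R by ring.
    apply Rmult_le_compat; [| apply pos_INR | exact IH |].
    + apply Rmult_le_pos; [lra | apply pos_INR].
    + apply Rle_trans with (2 := Hf (S n)); rewrite (S_INR (S n)); lra.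
Qed.

(** Each term after the leading 1 carries n! / (c)_n, at most 1 / Re c in modulus, and the rest is
    bounded independently of c. The 4 is the sum of the geometric series of ratio 3/4. *)
Lemma hyp_large_c (a b : C) : exists K : R, forall c : C, (1 <= Re c)%R ->
  (Cmod (Gamma c * hyp a b c - 1) <= K / Re c)%R.
Proof.
  destruct (subexp_half_bound _
    (subexp_mult _ _ (subexp_poch_fact a) (subexp_poch_fact b))) as [K HK].
  exists (4 * K)%R; intros c Hc.
  assert (Hg : good c) by (apply good_Re_pos; lra).
  pose (x := fun n => Gamma c * hyp_term a b c n).
  assert (HK0 : (0 <= K)%R).
  { generalize (HK 0%nat); generalize (Cmod_ge_0 (poch a 0 / #(fact 0)
      * (poch b 0 / #(fact 0)) * (/ 2) ^ 0)); simpl pow; lra. }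
  assert (Hx : is_series x (Gamma c * hyp a b c)).
  { apply is_Cseries_mult_l, is_series_hyp. }
  assert (Hx0 : x 0%nat = 1).
  { unfold x; rewrite hyp_term_good by exact Hg; simpl.
    field; auto using Gamma_neq_0, C1_nz. }
  assert (Hy : is_series (fun n => x (S n)) (Gamma c * hyp a b c - 1)).
  { apply (is_series_incr_1 (V := C_NormedModule)); rewrite Hx0.
    change (is_series x (Gamma c * hyp a b c - 1 + 1)).
    replace (Gamma c * hyp a b c - 1 + 1) with (Gamma c * hyp a b c) by ring.
    exact Hx. }
  assert (Hb : forall n, (Cmod (x (S n)) <= K / Re c * (3 / 4) ^ n)%R).
  { intros n; unfold x; rewrite hyp_term_good by exact Hg.
    set (h := (/ 2) ^ S n).
    replace (Gamma c * (/ Gamma c *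
       (poch a (S n) * poch b (S n) / (poch c (S n) * #(fact (S n))) * h)))
      with ((poch a (S n) / #(fact (S n)) * (poch b (S n) / #(fact (S n))) * h)
            * (#(fact (S n)) / poch c (S n)))
      by (field; auto using Gamma_neq_0, poch_neq_0, fact_C_neq_0).
    rewrite Cmod_mult.
    replace (K / Re c * (3 / 4) ^ n)%R with ((K * (3 / 4) ^ n) * / Re c)%R
      by (unfold Rdiv; ring).
    apply Rmult_le_compat; try apply Cmod_ge_0.
    - apply Rle_trans with (1 := HK (S n)).
      apply Rmult_le_compat_l; [exact HK0 |].
      assert (0 <= (3 / 4) ^ n)%R by (apply pow_le; lra); simpl; lra.
    - rewrite Cmod_div by now apply poch_neq_0.
      pose proof (Cmod_poch_ge c n Hc) as Hp.
      assert (Hf : (0 < INR (fact (S n)))%R) by apply INR_fact_lt_0.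
      rewrite Cmod_R, Rabs_pos_eq by lra.
      replace (/ Re c)%R
        with (INR (fact (S n)) * / (Re c * INR (fact (S n))))%R by (field; lra).
      apply Rmult_le_compat_l; [lra |].
      apply Rinv_le_contravar; [nra | exact Hp]. }
  pose proof (is_series_Cmod_tail _ _ (K / Re c) (3 / 4) 0 ltac:(lra) Hb Hy) as Ht.
  rewrite csum_0 in Ht; specialize (Hb 0%nat).
  set (l := Gamma c * hyp a b c - 1) in *.
  replace l with ((l - x 1%nat) + x 1%nat) by ring.
  apply Rle_trans with (1 := Cmod_triangle _ _).
  replace (4 * K / Re c)%R with (3 * (K / Re c) + K / Re c)%R by (unfold Rdiv; ring).
  apply Rplus_le_compat.
  - apply Rle_trans with (1 := Ht); simpl; lra.
  - simpl in Hb; lra.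
Qed.

(** * Gauss's second summation theorem and its contiguous forms *)

(** The series divided by its value in Gauss's theorem, in which Gamma(1/2) / Gamma((a + 1) / 2) is
    written as 2^(a - 1) Gamma(a / 2) / Gamma(a). This form avoids the duplication formula and is
    already the shape of the summands over r. *)
Definition gauss_quotient (a b : C) : C :=
  hyp a b ((a + b + 1) / 2) * Gamma a * Gamma ((b + 1) / 2)
  / (cpow 2 (a - 1) * Gamma (a / 2)).

Lemma Gamma_double_step (a : C) : good a -> Gamma (a + 2) = a * (a + 1) * Gamma a.
Proof.
  intros Ha; replace (a + 2) with (a + 1 + 1) by ring.
  rewrite Gamma_S by now apply good_S.
  rewrite Gamma_S by exact Ha; ring.
Qed.

Lemma cpow_2_double_step (a : C) : cpow 2 (a + 2 - 1) = 4 * cpow 2 (a - 1).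
Proof.
  replace (a + 2 - 1) with (a - 1 + 1 + 1) by ring.
  rewrite !cpow_S by lra; ring.
Qed.

Lemma gauss_quotient_step (a b : C) : good a -> good ((b + 1) / 2) ->
  gauss_quotient a b = gauss_quotient (a + 2) (b + 2).
Proof.
  intros Ha Hb; unfold gauss_quotient; rewrite hyp_double_step.
  rewrite Gamma_double_step, cpow_2_double_step by exact Ha.
  replace ((b + 2 + 1) / 2) with ((b + 1) / 2 + 1) by field.
  replace ((a + 2) / 2) with (a / 2 + 1) by field.
  rewrite (Gamma_S ((b + 1) / 2)) by exact Hb.
  rewrite (Gamma_S (a / 2)) by now apply good_half.
  set (h := hyp _ _ _).
  field; repeat split; auto using cpow_neq_0, Gamma_neq_0, good_half, good_neq_0.
Qed.

Lemma gauss_quotient_steps (a b : C) (k : nat) : good a -> good ((b + 1) / 2) ->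
  gauss_quotient a b = gauss_quotient (a + #(2 * k)) (b + #(2 * k)).
Proof.
  intros Ha Hb; induction k as [| k IH].
  - simpl; now rewrite !Cplus_0_r.
  - rewrite IH, gauss_quotient_step.
    + replace (#(2 * S k)) with (#(2 * k) + 2); [now rewrite !Cplus_assoc |].
      replace (2 * S k)%nat with (S (S (2 * k))) by lia.
      rewrite !RtoC_INR_S; ring.
    + now apply good_add.
    + replace ((b + #(2 * k) + 1) / 2) with ((b + 1) / 2 + #k).
      * now apply good_add.
      * rewrite mult_INR, RtoC_mult; simpl (INR 2).
        replace (RtoC (1 + 1)) with (RtoC 2) by (f_equal; ring).
        field.
Qed.

(** Euler's transformation makes the upper parameters c - a and c - b independent of k. The powers
    left over cancel because a + (b + 1) / 2 = c + a / 2 for base k, and (b - c + 1) + a = c for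
    base 2. *)
Lemma gauss_quotient_factor (a b : C) (k : nat) :
  (1 <= k)%nat -> good a -> good ((a + b + 1) / 2) -> good ((b + 1) / 2) ->
  let asym z n := Gamma (z + #n) * #n / (cpow (INR n) z * #(fact n)) in
  let c := (a + b + 1) / 2 in
  gauss_quotient (a + #(2 * k)) (b + #(2 * k))
  = (Gamma (c + #(2 * k)) * hyp (c - a) (c - b) (c + #(2 * k)))
    * (asym a (2 * k)%nat * / asym c (2 * k)%nat)
    * (asym ((b + 1) / 2) k * / asym (a / 2) k).
Proof.
  intros Hk Ha Hc Hb asym c; fold c in Hc.
  assert (E2 : #(2 * k) = 2 * #k).
  { rewrite mult_INR, RtoC_mult; simpl (INR 2); f_equal; f_equal; ring. }
  assert (Hk0 : (0 < INR k)%R) by (apply lt_0_INR; lia).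
  assert (Hk1 : #k <> 0) by (apply RtoC_neq_0; lra).
  assert (HP : forall z, cpow (INR (2 * k)) z = cpow 2 z * cpow (INR k) z).
  { intros z; rewrite mult_INR.
    rewrite <- cpow_base_mult by lra; f_equal; simpl; ring. }
  assert (P2 : cpow 2 (b - c + 1) * cpow 2 a = cpow 2 c).
  { rewrite <- cpow_plus; f_equal; unfold c; field. }
  assert (Pk : cpow (INR k) a * cpow (INR k) ((b + 1) / 2)
               = cpow (INR k) c * cpow (INR k) (a / 2)).
  { rewrite <- !cpow_plus; f_equal; unfold c; field. }
  unfold gauss_quotient.
  replace ((a + #(2 * k) + (b + #(2 * k)) + 1) / 2) with (c + #(2 * k))
    by (unfold c; field).
  rewrite hyp_euler by now apply good_add.
  replace (c + #(2 * k) - (a + #(2 * k))) with (c - a) by ring.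
  replace (c + #(2 * k) - (b + #(2 * k))) with (c - b) by ring.
  replace (cpow 2 (a + #(2 * k) + (b + #(2 * k)) - (c + #(2 * k))))
    with (cpow 2 (b - c + 1) * cpow 2 (a + #(2 * k) - 1))
    by (rewrite <- cpow_plus; f_equal; ring).
  replace ((b + #(2 * k) + 1) / 2) with ((b + 1) / 2 + #k) by (rewrite E2; field).
  replace ((a + #(2 * k)) / 2) with (a / 2 + #k) by (rewrite E2; field).
  unfold asym; rewrite !HP, E2.
  set (H := hyp _ _ _).
  pose proof (Gamma_neq_0 _ (good_add _ (2 * k) Hc)) as G1; rewrite E2 in G1.
  pose proof (Gamma_neq_0 _ (good_add _ k (good_half _ Ha))) as G2.
  transitivity (cpow 2 (b - c + 1) * H * Gamma (a + 2 * #k)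
    * Gamma ((b + 1) / 2 + #k) / Gamma (a / 2 + #k)).
  { field; auto using cpow_neq_0. }
  transitivity (H * Gamma (a + 2 * #k) * Gamma ((b + 1) / 2 + #k)
    / Gamma (a / 2 + #k) * (cpow 2 c / cpow 2 a)
    * ((cpow (INR k) c * cpow (INR k) (a / 2))
       / (cpow (INR k) a * cpow (INR k) ((b + 1) / 2)))).
  { rewrite <- Pk, <- P2; field; auto using cpow_neq_0. }
  field; repeat split; auto using cpow_neq_0, fact_C_neq_0, C2_neq_0.
Qed.

(** The quotient is constant along the double steps, and each factor of its shifted form tends to 1.
    Positive real parts keep the arguments away from the poles. *)
Lemma gauss_quotient_large (a b : C) : (0 < Re a)%R -> (0 < Re b)%R ->
  gauss_quotient a b = 1.
Proof.
  intros HRa HRb.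
  assert (Ha : good a) by now apply good_Re_pos.
  assert (HRc : (1 / 2 < Re ((a + b + 1) / 2))%R).
  { replace ((a + b + 1) / 2) with (RtoC (/ 2) * (a + b + 1))
      by (rewrite RtoC_inv by lra; field).
    rewrite re_scal_l; simpl; unfold Re in *; lra. }
  assert (Hc : good ((a + b + 1) / 2)) by (apply good_Re_pos; lra).
  assert (Hb : good ((b + 1) / 2)).
  { apply good_half, good_S; now apply good_Re_pos. }
  set (c := (a + b + 1) / 2) in *.
  assert (Hdbl : filterlim (fun k => (2 * k)%nat) eventually eventually).
  { intros Q [N HN]; exists N; intros n Hn; apply HN; lia. }
  pose (asym := fun z n => Gamma (z + #n) * #n / (cpow (INR n) z * #(fact n))).
  symmetry; apply (Clim_unique (fun _ => gauss_quotient a b)); [| apply Clim_const].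
  apply Clim_ext_loc with (N := 1%nat) (u := fun k =>
    (Gamma (c + #(2 * k)) * hyp (c - a) (c - b) (c + #(2 * k)))
    * (asym a (2 * k)%nat * / asym c (2 * k)%nat)
    * (asym ((b + 1) / 2) k * / asym (a / 2) k)).
  { intros k Hk; rewrite (gauss_quotient_steps a b k Ha Hb).
    symmetry; now apply gauss_quotient_factor. }
  assert (A : forall z, good z -> Clim (asym z) 1) by (intros z; apply Gamma_asymptotic).
  assert (A2 : forall z, good z -> Clim (fun k => asym z (2 * k)%nat) 1).
  { intros z Hz; apply (Clim_comp (asym z) 1 _ Hdbl), A, Hz. }
  assert (I1 : / RtoC 1 = 1) by (field; exact C1_nz).
  refine (eq_ind (1 * (1 * / 1) * (1 * / 1)) (Clim _) _ 1 _); [| rewrite I1; ring].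
  apply Clim_mult; [apply Clim_mult |].
  - destruct (hyp_large_c (c - a) (c - b)) as [K HK].
    assert (H : Clim (fun k => Gamma (c + #(2 * S k))
                   * hyp (c - a) (c - b) (c + #(2 * S k))) 1).
    { apply Clim_of_Cmod with (fun k => Rabs K * / INR (S k))%R.
      - intros k.
        assert (HR : (INR (S k) <= Re (c + #(2 * S k)))%R).
        { change (Re (c + #(2 * S k))) with (Re c + INR (2 * S k))%R.
          rewrite mult_INR; simpl (INR 2); pose proof (pos_INR (S k)); lra. }
        assert (H1 : (1 <= INR (S k))%R)
          by (rewrite S_INR; pose proof (pos_INR k); lra).
        apply Rle_trans with (1 := HK (c + #(2 * S k)) ltac:(lra)).
        apply Rle_trans with (Rabs K * / Re (c + #(2 * S k)))%R.
        + apply Rmult_le_compat_r; [left; apply Rinv_0_lt_compat; lra | apply Rle_abs].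
        + apply Rmult_le_compat_l; [apply Rabs_pos |].
          apply Rinv_le_contravar; lra.
      - replace (Finite 0) with (Finite (Rabs K * 0)) by (f_equal; ring).
        apply is_lim_seq_mult'; [apply is_lim_seq_const |].
        replace (Finite 0) with (Rbar_inv p_infty) by reflexivity.
        apply is_lim_seq_inv; [| discriminate].
        apply is_lim_seq_incr_1 with (u := INR), is_lim_seq_INR. }
    exact (Clim_incr_1 _ _ H).
  - apply Clim_mult; [now apply A2 | apply Clim_inv; [exact C1_nz | now apply A2]].
  - apply Clim_mult; [now apply A |].
    apply Clim_inv; [exact C1_nz | now apply A, good_half].
Qed.

(** The double step carries the identity back from (a + 2, b + 2) to (a, b), starting in the region
    of positive real parts. With [/ Gamma ((b + 1) / 2)] as a factor, [inv_Gamma_S] also covers the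
    poles met on the way, where both sides vanish. *)
Lemma gauss_second_descent (a b : C) (k : nat) : good a ->
  (0 < Re a + 2 * INR k)%R -> (0 < Re b + 2 * INR k)%R ->
  hyp a b ((a + b + 1) / 2) * Gamma a
  = cpow 2 (a - 1) * (Gamma (a / 2) * / Gamma ((b + 1) / 2)).
Proof.
  revert a b; induction k as [| k IH]; intros a b Ha HRa HRb.
  - simpl in HRa, HRb.
    assert (Hb : good ((b + 1) / 2)).
    { apply good_half, good_S, good_Re_pos; lra. }
    pose proof (gauss_quotient_large a b ltac:(lra) ltac:(lra)) as E.
    unfold gauss_quotient in E.
    pose proof (Gamma_neq_0 _ Hb) as G1.
    pose proof (Gamma_neq_0 _ (good_half _ Ha)) as G2.
    pose proof (cpow_neq_0 2 (a - 1)) as G3.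
    set (x := hyp a b ((a + b + 1) / 2) * Gamma a) in *.
    transitivity ((x * Gamma ((b + 1) / 2) / (cpow 2 (a - 1) * Gamma (a / 2)))
      * (cpow 2 (a - 1) * (Gamma (a / 2) * / Gamma ((b + 1) / 2)))).
    + field; auto.
    + rewrite E; ring.
  - assert (HR : forall z : C, Re (z + 2) = (Re z + 2)%R) by reflexivity.
    rewrite S_INR in HRa, HRb.
    assert (Ha2 : good (a + 2)) by exact (good_add a 2 Ha).
    specialize (IH (a + 2) (b + 2) Ha2).
    rewrite !HR in IH; specialize (IH ltac:(lra) ltac:(lra)).
    rewrite Gamma_double_step, cpow_2_double_step in IH by exact Ha.
    replace ((a + 2) / 2) with (a / 2 + 1) in IH by field.
    replace ((b + 2 + 1) / 2) with ((b + 1) / 2 + 1) in IH by field.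
    rewrite Gamma_S in IH by now apply good_half.
    rewrite hyp_double_step, (inv_Gamma_S ((b + 1) / 2)).
    set (g := / Gamma ((b + 1) / 2 + 1)) in *; set (h := hyp _ _ _) in *.
    pose proof (good_neq_0 _ Ha) as Ha0.
    transitivity ((b + 1) / (4 * a) * (h * (a * (a + 1) * Gamma a)));
      [field; exact Ha0 |].
    rewrite IH; field; exact Ha0.
Qed.

Lemma gauss_second (a b : C) : good a ->
  hyp a b ((a + b + 1) / 2) * Gamma a
  = cpow 2 (a - 1) * (Gamma (a / 2) * / Gamma ((b + 1) / 2)).
Proof.
  intros Ha.
  destruct (nat_above (Rabs (Re a) + Rabs (Re b) + 1)) as [N HN].
  specialize (HN N (le_n N)).
  pose proof (Rle_abs (- Re a)) as H1; rewrite Rabs_Ropp in H1.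
  pose proof (Rle_abs (- Re b)) as H2; rewrite Rabs_Ropp in H2.
  pose proof (Rabs_pos (Re a)); pose proof (Rabs_pos (Re b)).
  apply (gauss_second_descent a b N Ha); lra.
Qed.

(** [hyp_contiguous_b] and Pascal's rule split the two sides alike: the second halves are the case
    (a + 1, b + 1), which moves r to r + 1 and the lower parameter up by 1. The factor a / 2 is
    absorbed by Gamma(a + 1) and the doubled power of 2. *)
Lemma gauss_second_plus (i : nat) : forall a b : C, good a ->
  hyp a (b + #i) ((a + b + 1) / 2) * Gamma a
  = cpow 2 (a - 1) * sum_n (fun r => bin i r *
      (Gamma ((a + #r) / 2) * / Gamma ((b + #r + 1) / 2))) i.
Proof.
  induction i as [| i IH]; intros a b Ha.
  - rewrite csum_0, bin_0_r; simpl (INR 0); rewrite !Cplus_0_r, Cmult_1_l.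
    now apply gauss_second.
  - rewrite csum_pascal.
    rewrite RtoC_INR_S, Cplus_assoc, hyp_contiguous_b.
    pose proof (IH a b Ha) as E1.
    pose proof (IH (a + 1) (b + 1) (good_S a Ha)) as E2.
    replace ((a + 1 + (b + 1) + 1) / 2) with ((a + b + 1) / 2 + 1) in E2 by field.
    replace (b + 1 + #i) with (b + #i + 1) in E2 by ring.
    replace (a + 1 - 1) with (a - 1 + 1) in E2 by ring.
    rewrite Gamma_S, cpow_S in E2 by (assumption || lra).
    rewrite (csum_ext (fun r => bin i r * (Gamma ((a + #(S r)) / 2)
                * / Gamma ((b + #(S r) + 1) / 2)))
      (fun r => bin i r * (Gamma ((a + 1 + #r) / 2)
                * / Gamma ((b + 1 + #r + 1) / 2)))).
    + rewrite Cmult_plus_distr_l, <- E1.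
      transitivity (hyp a (b + #i) ((a + b + 1) / 2) * Gamma a
        + / 2 * (hyp (a + 1) (b + #i + 1) ((a + b + 1) / 2 + 1) * (a * Gamma a)));
        [field |].
      rewrite E2; cfield.
    + intros r _; rewrite RtoC_INR_S.
      replace (a + (#r + 1)) with (a + 1 + #r) by ring.
      replace (b + (#r + 1) + 1) with (b + 1 + #r + 1) by ring; reflexivity.
Qed.

(** The halves of Pascal's rule are now the cases (a, b - 2), with lower parameter c - 1, and (a +
    1, b - 1), with lower parameter c; [hyp_contiguous_c] expresses the first through the second and
    the new series. The Pochhammer factor collects the coefficients c - 1 - a without dividing by
    them. *)
Lemma gauss_second_minus (i : nat) : forall a b : C, good a ->
  poch ((b - a + 1) / 2 - #i) i * (hyp a (b - #i) ((a + b + 1) / 2) * Gamma a)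
  = cpow 2 (a - 1) * sum_n (fun r => bin i r *
      ((-1) ^ r * (Gamma ((a + #r) / 2) * / Gamma ((b + #r + 1) / 2 - #i)))) i.
Proof.
  induction i as [| i IH]; intros a b Ha.
  - rewrite csum_0, bin_0_r; simpl (INR 0); simpl poch; simpl Cpow.
    replace (b - 0) with b by ring.
    replace ((b + 0 + 1) / 2 - 0) with ((b + 1) / 2) by field.
    rewrite gauss_second by exact Ha; rewrite Cplus_0_r; ring.
  - rewrite csum_pascal.
    pose proof (IH a (b - 2) Ha) as E1.
    pose proof (IH (a + 1) (b - 1) (good_S a Ha)) as E2.
    set (c := (a + b + 1) / 2).
    (* Both instances have this same base point; order i + 1 adds the single factor p + i = c - 1 -
       a. *)
    set (p := (b - a + 1) / 2 - #(S i)).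
    replace ((b - 2 - a + 1) / 2 - #i) with p in E1
      by (unfold p; rewrite RtoC_INR_S; field).
    replace ((b - 1 - (a + 1) + 1) / 2 - #i) with p in E2
      by (unfold p; rewrite RtoC_INR_S; field).
    replace ((a + 1 + (b - 1) + 1) / 2) with c in E2 by (unfold c; field).
    replace ((a + (b - 2) + 1) / 2) with (c - 1) in E1 by (unfold c; field).
    replace (a + 1 - 1) with (a - 1 + 1) in E2 by ring.
    rewrite Gamma_S, cpow_S in E2 by (assumption || lra).
    rewrite (hyp_contiguous_c a (b - 2 - #i) (c - 1)) in E1.
    replace (c - 1 + 1) with c in E1 by ring.
    replace (b - 2 - #i + 1) with (b - 1 - #i) in E1 by ring.
    replace (b - #(S i)) with (b - 1 - #i) by (rewrite RtoC_INR_S; ring).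
    rewrite (poch_S p).
    replace (p + #i) with (c - 1 - a)
      by (unfold p, c; rewrite RtoC_INR_S; field).
    rewrite (csum_ext (fun r => bin i r * ((-1) ^ S r * (Gamma ((a + #(S r)) / 2)
                * / Gamma ((b + #(S r) + 1) / 2 - #(S i)))))
      (fun r => (-1) * (bin i r * ((-1) ^ r * (Gamma ((a + 1 + #r) / 2)
                * / Gamma ((b - 1 + #r + 1) / 2 - #i)))))).
    + rewrite (csum_ext (fun r => bin i r * ((-1) ^ r * (Gamma ((a + #r) / 2)
                * / Gamma ((b + #r + 1) / 2 - #(S i)))))
        (fun r => bin i r * ((-1) ^ r * (Gamma ((a + #r) / 2)
                * / Gamma ((b - 2 + #r + 1) / 2 - #i))))).
      * rewrite csum_mult_l, Cmult_plus_distr_l, <- E1.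
        set (h := hyp (a + 1) (b - 1 - #i) c) in *.
        set (h' := hyp a (b - 1 - #i) c) in *.
        match type of E2 with _ = _ * ?S => set (s := S) in * end.
        transitivity (poch p i * ((a / 2 * h + (c - 1 - a) * h') * Gamma a)
          - / 2 * (poch p i * (h * (a * Gamma a)))); [cfield |].
        rewrite E2; cfield.
      * intros r _.
        replace ((b + #r + 1) / 2 - #(S i)) with ((b - 2 + #r + 1) / 2 - #i)
          by (rewrite RtoC_INR_S; field); reflexivity.
    + intros r _; rewrite Cpow_S, (RtoC_INR_S r).
      replace (a + (#r + 1)) with (a + 1 + #r) by ring.
      replace ((b + (#r + 1) + 1) / 2 - #(S i)) with ((b - 1 + #r + 1) / 2 - #i)
        by (rewrite RtoC_INR_S; field).
      ring.
Qed.

(** * Reduction of the double series *)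

Lemma pow_n_Cpow (z : C) (n : nat) : pow_n z n = z ^ n.
Proof.
  induction n as [| n IH]; [reflexivity |].
  rewrite Cpow_S, <- IH; reflexivity.
Qed.

Lemma kdf_term_factor (alpha beta A c h b d : C) (m n : nat) :
  good beta -> good h -> good d ->
  kdf_term [alpha] [beta] [A] [c; 1 + h; b] [] [h; d] (RtoC (1 / 2)) (RtoC (1 / 2)) m n
  = (poch alpha (m + n) / poch beta (m + n)) * (poch A m / #(fact m))
    * (poch c n * poch (1 + h) n * poch b n / (poch h n * poch d n * #(fact n)))
    * (/ 2) ^ (m + n).
Proof.
  intros Hb Hh Hd; unfold kdf_term, pochs; simpl fold_right.
  rewrite (pow_n_Cpow _ m), (pow_n_Cpow _ n), Cpow_add_r.
  replace (RtoC (1 / 2)) with (/ RtoC 2)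
    by (rewrite <- RtoC_inv by lra; f_equal; field).
  set (x := (/ 2) ^ m); set (y := (/ 2) ^ n).
  field; repeat split; auto using fact_C_neq_0, poch_neq_0, C1_nz.
Qed.

(** Multiplication by 1 - x on coefficients: for N >= 1 the claim comes down to (alpha + N)(d - c +
    N - 1) - N (d + N - 1) = alpha (d - c + N - 1) - N c. *)
Lemma antidiagonal_hyp (alpha c d : C) (N : nat) : good alpha -> good d ->
  poch alpha N / #(fact N)
    * ((poch (d - c) N * alpha - #N * c * poch (d - c) (pred N)) / (alpha * poch d N))
    * (/ 2) ^ N
  = Gamma d * (hyp_term (1 + alpha) (d - c) d N
               - half_shift (hyp_term (1 + alpha) (d - c) d) N).
Proof.
  intros Ha Hd; pose proof (good_neq_0 _ Ha) as Ha0.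
  pose proof (Gamma_neq_0 _ Hd) as HG.
  destruct N as [| N]; simpl half_shift; simpl pred.
  - rewrite hyp_term_good by exact Hd; simpl; field; auto using C1_nz.
  - rewrite !hyp_term_good by exact Hd.
    rewrite (poch_S_l alpha), (Cplus_comm alpha 1).
    rewrite !(poch_S (1 + alpha)), !(poch_S (d - c)), !(poch_S d).
    rewrite fact_C_S, Cpow_S, RtoC_INR_S.
    set (x := (/ 2) ^ N).
    field; repeat split;
      auto using fact_C_neq_0, RtoC_INR_S_neq_0, poch_neq_0, good_add_neq_0.
Qed.

Lemma kdf_sum_hyp (alpha beta c : C) :
  let d := 1 + (alpha + beta) / 2 in
  good alpha -> good beta -> good d ->
  kdf_sum [alpha] [beta] [beta - c] [c; 1 + alpha / 2; (alpha - beta) / 2]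
    [] [alpha / 2; d] (RtoC (1 / 2)) (RtoC (1 / 2))
    (Gamma d * (hyp (1 + alpha) (d - c) d / 2)).
Proof.
  intros d Ha Hb Hd.
  pose proof (good_half _ Ha) as Hh.
  pose (f := kdf_term [alpha] [beta] [beta - c] [c; 1 + alpha / 2; (alpha - beta) / 2]
    [] [alpha / 2; d] (RtoC (1 / 2)) (RtoC (1 / 2))).
  assert (Hf : forall m n, f m n =
    (poch alpha (m + n) / poch beta (m + n)) * (poch (beta - c) m / #(fact m))
    * (poch c n * poch (1 + alpha / 2) n * poch ((alpha - beta) / 2) n
       / (poch (alpha / 2) n * poch d n * #(fact n)))
    * (/ 2) ^ (m + n)).
  { intros m n; now apply kdf_term_factor. }
  assert (S1 : subexp (fun n => poch alpha n / poch beta n)).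
  { apply subexp_ext with
      (fun n => (poch alpha n / #(fact n)) * (#(fact n) / poch beta n)).
    - intros n; field; auto using fact_C_neq_0, poch_neq_0.
    - apply subexp_mult; [apply subexp_poch_fact | now apply subexp_fact_poch]. }
  assert (S2 : subexp (fun n => poch (beta - c) n / #(fact n)))
    by apply subexp_poch_fact.
  assert (S3 : subexp (fun n =>
    poch c n * poch (1 + alpha / 2) n * poch ((alpha - beta) / 2) n
       / (poch (alpha / 2) n * poch d n * #(fact n)))).
  { apply subexp_ext with (fun n => (poch c n / #(fact n))
      * (((poch (1 + alpha / 2) n / #(fact n)) * (#(fact n) / poch (alpha / 2) n))
         * ((poch ((alpha - beta) / 2) n / #(fact n)) * (#(fact n) / poch d n)))).
    - intros n; field; auto using fact_C_neq_0, poch_neq_0.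
    - apply subexp_mult; [apply subexp_poch_fact |].
      apply subexp_mult; apply subexp_mult;
        auto using subexp_poch_fact, subexp_fact_poch. }
  (* 18/25 = (6/5)^2 / 2: the first factor depends on m + n, the other two on m and n, so the rate
     6/5 enters twice. *)
  assert (HK : exists K, forall m n, (Cmod (f m n) <= K * (18 / 25) ^ (m + n))%R).
  { destruct (S1 (6 / 5)%R) as [K1 H1]; [lra |].
    destruct (S2 (6 / 5)%R) as [K2 H2]; [lra |].
    destruct (S3 (6 / 5)%R) as [K3 H3]; [lra |].
    exists (K1 * K2 * K3)%R; intros m n; rewrite Hf, !Cmod_mult, Cmod_pow.
    rewrite <- RtoC_inv, Cmod_R, Rabs_pos_eq by lra.
    replace (18 / 25)%R with (6 / 5 * (6 / 5) * / 2)%R by field.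
    rewrite !Rpow_mult_distr, <- !Rmult_assoc.
    apply Rmult_le_compat_r; [apply pow_le; lra |].
    replace (K1 * K2 * K3 * (6 / 5) ^ (m + n) * (6 / 5) ^ (m + n))%R
      with ((K1 * (6 / 5) ^ (m + n)) * (K2 * (6 / 5) ^ m) * (K3 * (6 / 5) ^ n))%R
      by (rewrite (pow_add (6 / 5) m n); ring).
    apply Rmult_le_compat; [| apply Cmod_ge_0 | | apply H3].
    - apply Rmult_le_pos; apply Cmod_ge_0.
    - apply Rmult_le_compat; auto using Cmod_ge_0. }
  destruct HK as [K HK].
  exists (fun m => CSeries (f m)).
  assert (Hrow : forall m, is_series (f m) (CSeries (f m))).
  { intros m; apply (is_series_CSeries _ (K * (18 / 25) ^ m) (18 / 25)); [lra |].
    intros n; rewrite Rmult_assoc, <- pow_add; apply HK. }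
  split; [exact Hrow |].
  apply (double_series_antidiagonal f _ _ K (18 / 25)); [lra | exact HK | exact Hrow |].
  pose (T := hyp_term (1 + alpha) (d - c) d).
  apply is_Cseries_ext with (fun N => Gamma d * (T N - half_shift T N)).
  - intros N; unfold T; rewrite <- antidiagonal_hyp by assumption.
    (* This one value meets both requirements alpha - 2 b = beta and 1 + alpha - b = d of the
       antidiagonal sum. *)
    pose (b := (alpha - beta) / 2).
    assert (E1 : alpha - 2 * b = beta) by (unfold b; field).
    assert (E2 : 1 + alpha - b = d) by (unfold b, d; field).
    pose proof (kdf_antidiagonal alpha b c N) as HA; rewrite E1, E2 in HA.
    rewrite <- HA by assumption.
    rewrite (csum_rev (fun m => f m (N - m)%nat)), Cmult_comm.
    rewrite <- csum_mult_l; apply csum_ext; intros n Hn.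
    rewrite Hf; replace (N - (N - n))%nat with n by lia.
    replace (N - n + n)%nat with N by lia; fold b.
    set (h := (/ 2) ^ N).
    field; repeat split; auto using fact_C_neq_0, poch_neq_0.
  - apply is_Cseries_mult_l.
    replace (hyp (1 + alpha) (d - c) d / 2)
      with (hyp (1 + alpha) (d - c) d - / 2 * hyp (1 + alpha) (d - c) d) by field.
    apply is_Cseries_minus; [| apply is_series_half_shift]; apply is_series_hyp.
Qed.

Theorem theorem7 (i : nat) (alpha beta : C) :
  (* denominator parameters are not non-positive integers *)
  ~ nonpos_int beta ->
  ~ nonpos_int (alpha / 2) ->
  ~ nonpos_int (1 + (alpha + beta) / 2) ->
  (* Gamma values common to both identities are finite
     (Gamma (1 + (alpha+beta)/2) is covered by the previous hypothesis) *)
  ~ nonpos_int (1 + alpha) ->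
  (forall r : nat, (r <= i)%nat -> ~ nonpos_int ((alpha + RtoC (INR r) + 1) / 2)) ->
  (* first identity *)
  ((~ nonpos_int (beta / 2 - alpha / 2 - RtoC (INR i)) ->
    ~ nonpos_int (beta / 2 - alpha / 2) ->
    (forall r : nat, (r <= i)%nat ->
       ~ nonpos_int ((beta + RtoC (INR r) + 1) / 2 - RtoC (INR i))) ->
    kdf_sum [alpha] [beta]
      [3 / 2 * beta - alpha / 2 - 1 - RtoC (INR i)]
      [(alpha - beta) / 2 + 1 + RtoC (INR i); 1 + alpha / 2; (alpha - beta) / 2]
      []
      [alpha / 2; 1 + (alpha + beta) / 2]
      (RtoC (1 / 2)) (RtoC (1 / 2))
      (cpow 2 (alpha - 1) * Gamma (beta / 2 - alpha / 2 - RtoC (INR i))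
         * Gamma (1 + (alpha + beta) / 2)
         / (Gamma (beta / 2 - alpha / 2) * Gamma (1 + alpha))
         * sum_n (fun r => pow_n (RtoC (-1)) r * RtoC (Binomial.C i r)
                    * Gamma ((alpha + RtoC (INR r) + 1) / 2)
                    / Gamma ((beta + RtoC (INR r) + 1) / 2 - RtoC (INR i))) i))
   /\
   (* second identity *)
   ((forall r : nat, (r <= i)%nat ->
       ~ nonpos_int ((beta + RtoC (INR r) + 1) / 2)) ->
    kdf_sum [alpha] [beta]
      [3 / 2 * beta - alpha / 2 - 1 + RtoC (INR i)]
      [(alpha - beta) / 2 + 1 - RtoC (INR i); 1 + alpha / 2; (alpha - beta) / 2]
      []
      [alpha / 2; 1 + (alpha + beta) / 2]
      (RtoC (1 / 2)) (RtoC (1 / 2))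
      (cpow 2 (alpha - 1) * Gamma (1 + (alpha + beta) / 2) / Gamma (1 + alpha)
         * sum_n (fun r => RtoC (Binomial.C i r)
                    * Gamma ((alpha + RtoC (INR r) + 1) / 2)
                    / Gamma ((beta + RtoC (INR r) + 1) / 2)) i))).
Proof.
  intros Hb Hh Hd H1a _.
  (* The condition on alpha / 2 excludes alpha = 0, the one on 1 + alpha excludes the negative
     integers. *)
  assert (Ha : good alpha).
  { intros [[| k] Hk].
    - apply Hh; exists 0%nat; rewrite Hk; simpl; rewrite Ropp_0; field.
    - apply H1a; exists k; rewrite Hk, S_INR, <- RtoC_plus; f_equal; ring. }
  pose proof (Gamma_neq_0 _ H1a) as HG1.
  set (d := 1 + (alpha + beta) / 2) in *.
  (* Gauss's theorem is used with a = 1 + alpha and b = beta, for which (a + b + 1) / 2 is [d]. *)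
  assert (Ed : (1 + alpha + beta + 1) / 2 = d) by (unfold d; field).
  assert (E2 : cpow 2 (1 + alpha - 1) = 2 * cpow 2 (alpha - 1)).
  { replace (1 + alpha - 1) with (alpha - 1 + 1) by ring; apply cpow_S; lra. }
  split.
  - intros Hp _ _.
    set (p := beta / 2 - alpha / 2 - RtoC (INR i)) in *.
    set (c := (alpha - beta) / 2 + 1 + RtoC (INR i)).
    pose proof (kdf_sum_hyp alpha beta c Ha Hb Hd) as HK; fold d in HK.
    replace (3 / 2 * beta - alpha / 2 - 1 - RtoC (INR i)) with (beta - c)
      by (unfold c; field).
    pose proof (gauss_second_minus i (1 + alpha) beta H1a) as HM.
    rewrite Ed, E2 in HM.
    replace (d - c) with (beta - RtoC (INR i)) in HK by (unfold d, c; field).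
    replace ((beta - (1 + alpha) + 1) / 2 - RtoC (INR i)) with p in HM
      by (unfold p; field).
    replace (beta / 2 - alpha / 2) with (p + RtoC (INR i)) by (unfold p; ring).
    (* The quotient Gamma(p + i) / Gamma(p) is the Pochhammer factor of [gauss_second_minus]. *)
    rewrite Gamma_add by exact Hp.
    rewrite (csum_ext _ (fun r => bin i r * ((-1) ^ r *
      (Gamma ((1 + alpha + RtoC (INR r)) / 2)
       * / Gamma ((beta + RtoC (INR r) + 1) / 2 - RtoC (INR i)))))).
    + pose proof (poch_neq_0 _ i Hp) as HP; pose proof (Gamma_neq_0 _ Hp) as HGp.
      match type of HM with _ = _ * ?S => set (s := S) in * end.
      match goal with |- kdf_sum _ _ _ _ _ _ _ _ ?v =>
        replace v with (Gamma d * (hyp (1 + alpha) (beta - RtoC (INR i)) d / 2)) end;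
        [exact HK |].
      set (h := hyp _ _ _) in *.
      transitivity (Gamma d / (2 * poch p i * Gamma (1 + alpha))
                    * (poch p i * (h * Gamma (1 + alpha)))).
      * cfield; auto.
      * rewrite HM; cfield; auto.
    + intros r _; rewrite pow_n_Cpow; unfold bin, Cdiv.
      replace (1 + alpha + RtoC (INR r)) with (alpha + RtoC (INR r) + 1) by ring.
      cring.
  - intros _.
    set (c := (alpha - beta) / 2 + 1 - RtoC (INR i)).
    pose proof (kdf_sum_hyp alpha beta c Ha Hb Hd) as HK; fold d in HK.
    replace (3 / 2 * beta - alpha / 2 - 1 + RtoC (INR i)) with (beta - c)
      by (unfold c; field).
    pose proof (gauss_second_plus i (1 + alpha) beta H1a) as HM.
    rewrite Ed, E2 in HM.
    replace (d - c) with (beta + RtoC (INR i)) in HK by (unfold d, c; field).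
    rewrite (csum_ext _ (fun r => bin i r *
      (Gamma ((1 + alpha + RtoC (INR r)) / 2)
       * / Gamma ((beta + RtoC (INR r) + 1) / 2)))).
    + match type of HM with _ = _ * ?S => set (s := S) in * end.
      match goal with |- kdf_sum _ _ _ _ _ _ _ _ ?v =>
        replace v with (Gamma d * (hyp (1 + alpha) (beta + RtoC (INR i)) d / 2)) end;
        [exact HK |].
      set (h := hyp _ _ _) in *.
      transitivity (Gamma d / (2 * Gamma (1 + alpha)) * (h * Gamma (1 + alpha))).
      * cfield; auto.
      * rewrite HM; cfield; auto.
    + intros r _; unfold bin, Cdiv.
      replace (1 + alpha + RtoC (INR r)) with (alpha + RtoC (INR r) + 1) by ring.
      cring.
Qed.
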